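(* Let $(\mathbf S,\mathbf R,\mathbf C)$ be an extended triangular system. Then $\mathcal T(\mathbf S,\mathbf R,\mathbf C)$ is a triangular algebra.
   Context: Setting. $\mathbb N=\{1,2,\dots\}$. $\mathcal H,\mathcal K$ are separable infinite-dimensional Hilbert spaces. A nest is a linearly ordered, weakly closed set of projections containing $0$ and $I$; $\mathrm{Alg}(\mathcal N)$ is the algebra of bounded operators leaving invariant the range of every projection in the nest $\mathcal N$. A nest is continuous if it has no atoms (minimal non-zero differences $N-M$ of projections $N>M$ in the nest). $\mathcal N_0$ is a multiplicity-free continuous nest on $\mathcal H$; up to unitary equivalence $\mathcal H=L^2[0,1]$ (Lebesgue measure) and $\mathcal N_0$ consists of the multiplications by the characteristic functions $\chi_{[0,t]}$, $t\in[0,1]$. $\mathcal N:=\mathcal N_0\otimes I_{\mathcal K}$, acting on $\mathcal H\otimes\mathcal K$. For Borel $S\subseteq[0,1]$, $E(S)$ is (multiplication by $\chi_S$)$\,\otimes I_{\mathcal K}$, and $N_t:=E([0,t])$ for $t\in[0,1]$, with $N_s=0$ for $s<0$ and $N_t=I$ for $t>1$. $\mathcal D_0$ is an atomic masa (maximal abelian self-adjoint algebra) on $\mathcal K$, $(e_i)_{i\in\mathbb N}$ is an orthonormal basis of $\mathcal K$ of unit vectors in the (one-dimensional) atoms of $\mathcal D_0$, $E_{i}:=I_{\mathcal H}\otimes(e_i\otimes e_i^* )$ where $(e_i\otimes e_j^* )(v)=\langle v,e_j\rangle e_i$, and $M_n:=\sum_{i=1}^nE_i$. ''a.e.'' refers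 to Lebesgue measure on $[0,1]$. Seminorms. For $X\in\mathrm{Alg}(\mathcal N)$, $t\in[0,1]$ and $i,j\in\mathbb N$: $i_t(X):=\inf\{\|(N_v-N_u)X(N_v-N_u)\| : u<t<v\}$, $r_{i,t}(X):=\lim_{k\to\infty}i_t(E_iXM_k^\perp)$, $c_{j,t}(X):=\lim_{k\to\infty}i_t(M_k^\perp XE_j)$. An extended triangular system is a triple $(\mathbf S,\mathbf R,\mathbf C)$ of collections of Borel subsets of $[0,1]$, $\mathbf S=(S_{i,j})_{i,j\in\mathbb N}$, $\mathbf R=(R_i)_{i\in\mathbb N}$, $\mathbf C=(C_j)_{j\in\mathbb N}$, such that: (1) $S_{i,i}=[0,1]$ for all $i$; (2) $S_{i,j}\cap S_{j,i}=\emptyset$ for all $i\ne j$; (3) $S_{i,j}\cap S_{j,k}\subseteq S_{i,k}$ for all $i,j,k$; (4) $C_i\cap S_{i,j}\subseteq C_j$ for all $i,j$; (5) $S_{i,j}\cap R_j\subseteq R_i$ for all $i,j$; (6) $R_i\cap C_j\subseteq S_{i,j}$ for all $i,j$. $\mathcal T(\mathbf S,\mathbf R,\mathbf C)$ is the set of all $X\in\mathrm{Alg}(\mathcal N)$ such that: $i_t(E_iXE_j)=0$ for all $i,j\in\mathbb N$ and a.e. $t\notin S_{i,j}$; $r_{i,t}(X)=0$ for all $i\in\mathbb N$ and a.e. $t\notin R_i$; $c_{j,t}(X)=0$ for all $j\in\mathbb N$ and a.e. $t\notin C_j$. A triangular algebra is an algebra $\mathcal T$ of bounded operators on a Hilbert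 space $\mathcal L$ such that $\mathcal T\cap\mathcal T^*$ is a masa in $B(\mathcal L)$. *)

(* Defs.v *)
From HB Require Import structures.
From mathcomp Require Import all_boot all_order all_algebra.
From mathcomp Require Import sesquilinear.
From mathcomp.real_closed Require Import complex.
From mathcomp Require Import all_classical all_reals all_analysis.

Set Implicit Arguments.
Unset Strict Implicit.
Unset Printing Implicit Defensive.

Import Order.TTheory GRing.Theory Num.Theory.
Import numFieldNormedType.Exports.

Local Open Scope classical_set_scope.
Local Open Scope complex_scope.
Local Open Scope ring_scope.

(** Complex Hilbert spaces; the inner product is linear in its first
    argument and conjugate-linear in its second one. *)
HB.mixin Record isHilbert (R : realType) V
    of CompleteNormedModule R[i] V := {
  dotp : {dot V for (@Num.conj R[i])} ;
  normr_dotp : forall x : V, `|x| ^+ 2 = dotp x x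
}.

#[short(type="hilbertType")]
HB.structure Definition Hilbert (R : realType) :=
  {V of CompleteNormedModule R[i] V & isHilbert R V}.

Notation "''<' x , y >" := (dotp x y)
  (at level 0, x at level 69, y at level 69, format "''<' x ,  y >")
  : ring_scope.

Definition orthonormal_basis (R : realType) (K : hilbertType R)
    (e : nat -> K) : Prop :=
  (forall i j, '<e i, e j> = (i == j)%:R) /\
  dense [set z : K | exists n (a : 'I_n -> R[i]), z = \sum_(i < n) a i *: e i].

(** Operators are plain functions. *)
Definition bounded_op (R : realType) (V : hilbertType R) (X : V -> V) : Prop :=
  linear X /\ exists M : R, forall x, `|X x| <= M%:C * `|x|.

Definition opnorm (R : realType) (V : hilbertType R) (X : V -> V) : R :=
  inf [set M : R | 0 <= M /\ forall x, `|X x| <= M%:C * `|x|].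

Definition is_adjoint (R : realType) (V : hilbertType R) (X Y : V -> V) : Prop :=
  forall x y, '<X x, y> = '<x, Y y>.

Definition adjoint_set (R : realType) (V : hilbertType R)
    (A : set (V -> V)) : set (V -> V) :=
  [set Y | exists2 X, A X & is_adjoint X Y].

Definition operator_algebra (R : realType) (V : hilbertType R)
    (A : set (V -> V)) : Prop :=
  [/\ A `<=` @bounded_op R V,
      A (fun=> 0),
      forall (a : R[i]) X Y, A X -> A Y -> A (fun x => a *: X x + Y x) &
      forall X Y, A X -> A Y -> A (X \o Y)].

Definition abelian_selfadjoint_algebra (R : realType) (V : hilbertType R)
    (A : set (V -> V)) : Prop :=
  [/\ operator_algebra A,
      adjoint_set A = A &
      forall X Y, A X -> A Y -> X \o Y = Y \o X].

Definition masa (R : realType) (V : hilbertType R) (A : set (V -> V)) : Prop :=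
  abelian_selfadjoint_algebra A /\
  forall B, abelian_selfadjoint_algebra B -> A `<=` B -> B `<=` A.

Definition triangular_algebra (R : realType) (V : hilbertType R)
    (T : set (V -> V)) : Prop :=
  operator_algebra T /\ masa (T `&` adjoint_set T).

Definition nest_alg (R : realType) (V : hilbertType R)
    (N : set (V -> V)) : set (V -> V) :=
  [set X | bounded_op X /\ forall P, N P -> X @` range P `<=` range P].

(** Complex L^2[0,1], Lebesgue measure. *)
Definition square_integrable (R : realType) (f : R -> R[i]) : Prop :=
  [/\ measurable_fun (`[0, 1]%classic : set R) (fun x => complex.Re (f x)),
      measurable_fun (`[0, 1]%classic : set R) (fun x => complex.Im (f x)) &
      (@lebesgue_measure R).-integrable `[0, 1]%classic
        (fun x => (complex.Re (f x) ^+ 2 + complex.Im (f x) ^+ 2)%:E)].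

Definition integral01 (R : realType) (f : R -> R[i]) : R[i] :=
  (\int[@lebesgue_measure R]_(x in `[0, 1]) complex.Re (f x)) +i*
  (\int[@lebesgue_measure R]_(x in `[0, 1]) complex.Im (f x)).

(** [U] induces a unitary from L^2[0,1] (square integrable functions modulo
    a.e. equality) onto [H]; its values at other functions are irrelevant. *)
Definition L2_unitary (R : realType) (H : hilbertType R)
    (U : (R -> R[i]) -> H) : Prop :=
  [/\ forall (a : R[i]) f g, square_integrable f -> square_integrable g ->
        U (fun x => a * f x + g x) = a *: U f + U g,
      forall f g, square_integrable f -> square_integrable g ->
        '<U f, U g> = integral01 (fun x => f x * (g x)^*) &
      forall h, exists2 f, square_integrable f & U f = h].

(** Multiplication by the characteristic function of [S], carried over to [H];
    by [L2_unitary] the choice of the representative of [h] is immaterial. *)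
Definition mul_indic (R : realType) (H : hilbertType R)
    (U : (R -> R[i]) -> H) (S : set R) (h : H) : H :=
  let f := xget (fun=> 0) [set f | square_integrable f /\ U f = h] in
  U (fun x => \1_S x * f x).

(** [L] is the Hilbert space tensor product of [H] and [K], with [tens h k]
    the elementary tensors. *)
Definition hilbert_tensor (R : realType) (H K L : hilbertType R)
    (tens : {bilinear H -> K -> L}) : Prop :=
  (forall h k h' k', '<tens h k, tens h' k'> = '<h, h'> * '<k, k'>) /\
  dense [set z : L | exists n (h : 'I_n -> H) (k : 'I_n -> K),
                       z = \sum_(i < n) tens (h i) (k i)].

(** The unique bounded operator mapping [tens h k] to [tens (A h) (B k)]. *)
Definition tensor_op (R : realType) (H K L : hilbertType R)
    (tens : {bilinear H -> K -> L}) (A : H -> H) (B : K -> K) : L -> L :=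
  xget (fun=> 0)
    [set T | bounded_op T /\ forall h k, T (tens h k) = tens (A h) (B k)].

(** The nests N_0 on H and N = N_0 (x) I on H (x) K. *)
Definition nest0 (R : realType) (H : hilbertType R) (U : (R -> R[i]) -> H) :
    set (H -> H) :=
  [set mul_indic U `[0, t]%classic | t in `[0, 1]%classic].

Definition nest (R : realType) (H K L : hilbertType R)
    (U : (R -> R[i]) -> H) (tens : {bilinear H -> K -> L}) : set (L -> L) :=
  [set tensor_op tens P id | P in nest0 U].

Definition spectral_proj (R : realType) (H K L : hilbertType R)
    (U : (R -> R[i]) -> H) (tens : {bilinear H -> K -> L}) (S : set R) :
    L -> L :=
  tensor_op tens (mul_indic U S) id.

Definition nest_proj (R : realType) (H K L : hilbertType R)
    (U : (R -> R[i]) -> H) (tens : {bilinear H -> K -> L}) (t : R) : L -> L :=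
  if t < 0 then fun=> 0
  else if 1 < t then id
  else spectral_proj U tens `[0, t]%classic.

Definition basis_proj (R : realType) (H K L : hilbertType R)
    (tens : {bilinear H -> K -> L}) (e : nat -> K) (i : nat) : L -> L :=
  tensor_op tens id (fun v => '<v, e i> *: e i).

(** For families [N] of nest projections and [E] of basis projections.  As the
    basis is indexed from 0, [partial_compl E n] is I minus the sum of the
    first [n] of the [E i]. *)
Definition partial_compl (R : realType) (L : hilbertType R)
    (E : nat -> L -> L) (n : nat) : L -> L :=
  fun x => x - \sum_(i < n) E i x.

Definition local_norm (R : realType) (L : hilbertType R)
    (N : R -> L -> L) (t : R) (X : L -> L) : R :=
  inf [set r : R | exists u v, [/\ u < t, t < v &
         r = opnorm ((N v \- N u) \o X \o (N v \- N u))]].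

Definition row_norm (R : realType) (L : hilbertType R)
    (N : R -> L -> L) (E : nat -> L -> L) (i : nat) (t : R) (X : L -> L) : R :=
  limn (fun k => local_norm N t (E i \o X \o partial_compl E k)).

Definition col_norm (R : realType) (L : hilbertType R)
    (N : R -> L -> L) (E : nat -> L -> L) (j : nat) (t : R) (X : L -> L) : R :=
  limn (fun k => local_norm N t (partial_compl E k \o X \o E j)).

Definition borel01 (R : realType) (A : set R) : Prop :=
  measurable A /\ A `<=` `[0, 1]%classic.

Definition extended_triangular_system (R : realType)
    (S : nat -> nat -> set R) (Rw C : nat -> set R) : Prop :=
  [/\ forall i j, borel01 (S i j),
      forall i, borel01 (Rw i) &
      forall j, borel01 (C j)] /\
  [/\ forall i, S i i = `[0, 1]%classic,
      forall i j, i <> j -> S i j `&` S j i = set0,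
      forall i j k, S i j `&` S j k `<=` S i k,
      forall i j, C i `&` S i j `<=` C j &
      forall i j, S i j `&` Rw j `<=` Rw i] /\
  (forall i j, Rw i `&` C j `<=` S i j).

Definition system_algebra (R : realType) (H K L : hilbertType R)
    (U : (R -> R[i]) -> H) (tens : {bilinear H -> K -> L}) (e : nat -> K)
    (S : nat -> nat -> set R) (Rw C : nat -> set R) : set (L -> L) :=
  let N := nest_proj U tens in
  let E := basis_proj tens e in
  [set X | [/\ nest_alg (nest U tens) X,
     forall i j, \forall t \ae (@lebesgue_measure R),
       t \in `[0, 1] -> ~ S i j t -> local_norm N t (E i \o X \o E j) = 0,
     forall i, \forall t \ae (@lebesgue_measure R),
       t \in `[0, 1] -> ~ Rw i t -> row_norm N E i t X = 0 &
     forall j, \forall t \ae (@lebesgue_measure R),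
       t \in `[0, 1] -> ~ C j t -> col_norm N E j t X = 0]].

(* Main.v *)
Require Import Defs.
From mathcomp Require Import all_boot all_order all_algebra sesquilinear.
From mathcomp.real_closed Require Import complex.
From mathcomp Require Import all_classical all_reals all_analysis.
From mathcomp Require Import measurable_realfun ring lra.

Set Implicit Arguments.
Unset Strict Implicit.
Unset Printing Implicit Defensive.

Import Order.TTheory GRing.Theory Num.Theory.
Import numFieldNormedType.Exports.

Local Open Scope classical_set_scope.
Local Open Scope complex_scope.
Local Open Scope ring_scope.

(** A local bound for X at t is a bound for D X D, where D = N_v - N_u and
    u < t < v.  Since D X Y D = (D X D)(D Y D) on Alg(N), local norms are
    submultiplicative, and the decomposition
    X Y = sum_(l < n) X E_l Y + X M_n^perp Y turns each axiom of an extended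
    triangular system into closure of T(S, R, C) under products.

    If both Y and its adjoint lie in T(S, R, C), then Y commutes with the nest
    and, for i <> j, E_i Y E_j vanishes locally at almost every t because
    S_ij and S_ji are disjoint.  The function s |-> <N_s E_i Y E_j x, y> is the
    integral of an L^1 function and its increments are locally dominated by
    eps times those of another absolutely continuous function, so Lebesgue's
    differentiation theorem gives E_i Y E_j = 0.  Hence T meets its adjoint in
    the commutant of the projections N_t and E_i.  This commutant is abelian,
    as the nest is multiplicity free on each range H (x) e_i, and it contains
    these projections, so every abelian self-adjoint algebra above it is
    contained in it. *)

(** * Hilbert spaces *)

(** Norms of compressions are not additive in the window, while the differentiation argument needs a
    dominating function of t. The Cauchy-Schwarz bound eps |Dx| |Dy| is therefore weakened to eps
    (|Dx|^2 + |Dy|^2): for D = N_b - N_a these squares are increments of t |-> |N_t x|^2, an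
    indefinite integral.

    The seminorms are infima of operator norms, which are infima themselves, followed by a limit.
    Only their vanishing matters, so they are traded for existence of a window for every eps > 0,
    and the countably many almost-everywhere conditions for a single null set. Closure under
    products then becomes a statement about one point t.

    Adjoints are relations between two operators; apart from projections, each adjoint used is a
    witness of membership in some [adjoint_set], which is why the lemmas on commutants carry pairs
    A, A'. Operators on the tensor product are chosen by [xget], so those in use must be shown to
    exist: they are extended from finite sums of elementary tensors. *)

Section LinearMaps.
Variables (K : pzRingType) (V W : lmodType K) (X : V -> W).
Hypothesis lX : linear X.

Lemma lin0 : X 0 = 0.
Proof. by have := lX (-1) 0 0; rewrite scaler0 addr0 scaleN1r addNr. Qed.

Lemma linD x y : X (x + y) = X x + X y.
Proof. by have := lX 1 x y; rewrite !scale1r. Qed.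

Lemma linZ a x : X (a *: x) = a *: X x.
Proof. by have := lX a x 0; rewrite lin0 !addr0. Qed.

Lemma linN x : X (- x) = - X x.
Proof. by rewrite -scaleN1r linZ scaleN1r. Qed.

Lemma linB x y : X (x - y) = X x - X y.
Proof. by rewrite linD linN. Qed.

Lemma lin_sum n (F : 'I_n -> V) : X (\sum_(i < n) F i) = \sum_(i < n) X (F i).
Proof. exact: (big_morph X linD lin0). Qed.

End LinearMaps.

Section HilbertBasics.
Variables (R : realType) (V : hilbertType R).
Implicit Types x y z : V.

Lemma dotpC x y : '<x, y> = ('<y, x>)^*%R.
Proof. by rewrite hermC /= expr0 mul1r. Qed.

Lemma dotpDl x y z : '<x + y, z> = '<x, z> + '<y, z>.
Proof. exact: linearDl. Qed.

Lemma dotpBl x y z : '<x - y, z> = '<x, z> - '<y, z>.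
Proof. exact: linearBl. Qed.

Lemma dotpZl a x z : '<a *: x, z> = a * '<x, z>.
Proof. exact: linearZl_LR. Qed.

Lemma dotp0l z : '<0, z> = 0 :> R[i].
Proof. exact: linear0l. Qed.

Lemma dotpDr x y z : '<z, x + y> = '<z, x> + '<z, y>.
Proof. exact: linearDr. Qed.

Lemma dotpBr x y z : '<z, x - y> = '<z, x> - '<z, y>.
Proof. exact: linearBr. Qed.

Lemma dotpZr a x z : '<z, a *: x> = a^*%R * '<z, x>.
Proof. exact: linearZr_LR. Qed.

Lemma dotp0r z : '<z, 0> = 0 :> R[i].
Proof. exact: linear0r. Qed.

Lemma dotp_suml n (F : 'I_n -> V) z :
  '<\sum_(i < n) F i, z> = \sum_(i < n) '<F i, z>.
Proof. exact: linear_sumlz. Qed.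

Lemma dotp_sumr n (F : 'I_n -> V) z :
  '<z, \sum_(i < n) F i> = \sum_(i < n) '<z, F i>.
Proof. exact: linear_sumr. Qed.

(** The norm takes its values in [R[i]]; its real part makes the order and the arithmetic tactics of
    [R] available. *)
Definition nrm x : R := complex.Re `|x|.

Lemma nrmE x : `|x| = (nrm x)%:C.
Proof. by rewrite /nrm RRe_real// normr_real. Qed.

Lemma nrm_ge0 x : 0 <= nrm x.
Proof. by rewrite -ler0c -nrmE. Qed.

Lemma nrm0 : nrm 0 = 0.
Proof. by apply: complexI; rewrite -nrmE normr0. Qed.

Lemma nrm_eq0 x : nrm x = 0 -> x = 0.
Proof. by move=> x0; apply/normr0_eq0; rewrite nrmE x0. Qed.

Lemma nrmD x y : nrm (x + y) <= nrm x + nrm y.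
Proof. by rewrite -lecR rmorphD /= -!nrmE ler_normD. Qed.

Lemma nrmN x : nrm (- x) = nrm x.
Proof. by rewrite /nrm normrN. Qed.

Lemma nrmC x y : nrm (x - y) = nrm (y - x).
Proof. by rewrite -nrmN opprB. Qed.

Lemma nrmB x y : nrm (x - y) <= nrm x + nrm y.
Proof. by rewrite -[nrm y]nrmN nrmD. Qed.

Lemma nrmZ (a : R[i]) x : nrm (a *: x) = complex.Re `|a| * nrm x.
Proof.
apply: complexI; rewrite -nrmE normrZ nrmE.
by rewrite rmorphM /= RRe_real// normr_real.
Qed.

Lemma dotpp x : '<x, x> = (nrm x ^+ 2)%:C.
Proof. by rewrite -normr_dotp nrmE rmorphXn. Qed.

Lemma dot_CS x y : `|'<x, y>| <= (nrm x * nrm y)%:C.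
Proof.
have [y0|y0] := eqVneq (nrm y) 0.
  by rewrite (nrm_eq0 y0) dotp0r normr0 nrm0 mulr0.
have n0 : 0 < nrm y by rewrite lt_def y0 nrm_ge0.
have c0 : 0 < ((nrm y ^+ 2)%:C : R[i]) by rewrite ltcR exprn_gt0.
rewrite -(@ler_pXn2r _ 2)// ?nnegrE ?normr_ge0 ?ler0c ?mulr_ge0 ?nrm_ge0//.
rewrite rmorphM exprMn -!rmorphXn /= mulrC -subr_ge0 -(pmulr_rge0 _ c0).
set c := (_%:C) in c0 *; set d := '<x, y>.
have cJ : c^*%R = c by rewrite /c; exact: conjc_real.
(* With c = |y|^2 and d = <x, y> this square expands to c (c |x|^2 - |d|^2), the quantity to be
   shown nonnegative. *)
have : 0 <= '<c *: x - d *: y, c *: x - d *: y>.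
  by rewrite dotpp ler0c exprn_ge0 ?nrm_ge0.
congr (0 <= _); rewrite dotpBl !dotpBr !dotpZl !dotpZr cJ !dotpp -/c.
have -> : (Normc.normc d ^+ 2)%:C = d * d^*%R by rewrite rmorphXn; exact: normCK.
rewrite (dotpC y x) -/d; ring.
Qed.

Lemma nrm_bound x (M : R) : 0 <= M ->
  (forall y, `|'<x, y>| <= (M * nrm y)%:C) -> nrm x <= M.
Proof.
move=> M0 /(_ x); rewrite dotpp ger0_norm ?ler0c ?exprn_ge0 ?nrm_ge0//.
rewrite lecR expr2; have [->//|x0] := eqVneq (nrm x) 0.
by rewrite ler_pM2r// lt_def x0 nrm_ge0.
Qed.

Lemma dotp_inj x y : (forall z, '<x, z> = '<y, z>) -> x = y.
Proof.
move=> xy; apply/eqP; rewrite -subr_eq0; apply/eqP/nrm_eq0/eqP.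
by rewrite -sqrf_eq0 -(inj_eq (@complexI R)) -dotpp dotpBl xy subrr.
Qed.

Lemma dotp_injr x y : (forall z, '<z, x> = '<z, y>) -> x = y.
Proof. by move=> xy; apply: dotp_inj => z; rewrite dotpC xy -dotpC. Qed.

Lemma denseP (A : set V) : dense A ->
  forall x (eps : R), 0 < eps -> exists2 a, A a & nrm (x - a) < eps.
Proof.
move=> dA x eps e0; have e0' : 0 < eps%:C :> R[i] by rewrite ltcR.
have nO : ball x eps%:C !=set0 by exists x; exact: ballxx.
have [a [xa Aa]] := dA _ nO (ball_open x eps%:C).
by exists a => //; move: xa; rewrite -ball_normE /= nrmE ltcR.
Qed.

Lemma cauchy_lim (u : nat -> V) :
  (forall eps : R, 0 < eps -> exists N, forall m n, (N <= m)%N -> (N <= n)%N ->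
     nrm (u m - u n) < eps) ->
  exists l, forall eps : R, 0 < eps -> exists N, forall n, (N <= n)%N ->
     nrm (l - u n) < eps.
Proof.
move=> cu.
have uc : cvg (u @ \oo).
  apply: cauchy_cvg; apply: cauchy_exP => e e0.
  have eE : e = (complex.Re e)%:C by rewrite RRe_real// gtr0_real.
  have [|N NP] := cu (complex.Re e); first by rewrite -ltcR -eE.
  exists (u N); exists N => // n /= Nn.
  by rewrite -ball_normE /= nrmE eE ltcR NP.
exists (lim (u @ \oo)) => eps e0.
have e0' : 0 < eps%:C :> R[i] by rewrite ltcR.
have /cvgrPdist_lt/(_ _ e0')[N _ NP] := uc.
by exists N => n Nn; rewrite -ltcR -nrmE NP.
Qed.

Definition projection (P : V -> V) : Prop :=
  [/\ linear P, forall x, P (P x) = P x &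
      forall x y, '< P x , y > = '< x , P y > ].

(** Cauchy-Schwarz gives |x|^2 <= |x| |y|. This is the source of contractivity wherever x is the
    image of y under a symmetric idempotent map, including maps so far defined on finite sums
    only. *)
Lemma sqr_dot_bound x y : '<x, x> = '<x, y> -> nrm x <= nrm y.
Proof.
move=> xy; have := dot_CS x y.
rewrite -xy dotpp ger0_norm ?ler0c ?exprn_ge0 ?nrm_ge0//.
rewrite lecR expr2; have [->|x0] := eqVneq (nrm x) 0; first by rewrite nrm_ge0.
by rewrite ler_pM2l// lt_def x0 nrm_ge0.
Qed.

Lemma proj_nrm P x : projection P -> nrm (P x) <= nrm x.
Proof.
move=> [_ PP Ps]; apply: sqr_dot_bound.
by rewrite -Ps PP.
Qed.

End HilbertBasics.

Section BoundedOperators.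
Variables (R : realType) (V : hilbertType R).
Implicit Types (X Y P Q : V -> V) (x y z : V).

Lemma projection_id : projection (@id V).
Proof. by []. Qed.

Lemma contraction_bounded_op (T : V -> V) :
  linear T -> (forall x, nrm (T x) <= nrm x) -> bounded_op T.
Proof. by move=> lT bT; split=> //; exists 1 => x; rewrite mul1r !nrmE lecR. Qed.

Lemma proj_bounded P : projection P -> bounded_op P.
Proof.
move=> pP; have [lP _ _] := pP.
by apply: contraction_bounded_op => // x; exact: proj_nrm.
Qed.

Lemma comp_bounded P Q : bounded_op P -> bounded_op Q -> bounded_op (P \o Q).
Proof.
move=> [lP [c cP]] [lQ [d dQ]]; split; first by move=> a x y; rewrite /= lQ lP.
exists (`|c| * d) => x /=; apply: le_trans (cP _) _.
apply: (@le_trans _ _ (`|c|%:C * `|Q x|)); first by rewrite ler_wpM2r// lecR ler_norm.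
by rewrite rmorphM -mulrA /= ler_wpM2l// ler0c.
Qed.

Lemma bounded_nrm X : bounded_op X ->
  exists c, 0 <= c /\ forall x, nrm (X x) <= c * nrm x.
Proof.
move=> [_ [c cX]]; exists `|c|; split=> // x; rewrite -lecR -nrmE.
apply: le_trans (cX x) _; rewrite nrmE -rmorphM lecR.
by rewrite ler_wpM2r ?nrm_ge0// ler_norm.
Qed.

Lemma adjointC X Y : is_adjoint X Y -> is_adjoint Y X.
Proof. by move=> XY x y; rewrite dotpC -XY -dotpC. Qed.

Lemma adjoint_unique X Y Y' : is_adjoint X Y -> is_adjoint X Y' -> Y = Y'.
Proof.
by move=> XY XY'; apply/funext => y; apply: dotp_injr => z; rewrite -XY -XY'.
Qed.

Lemma adjoint_commute X Y P : projection P -> is_adjoint X Y ->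
  (forall x, X (P x) = P (X x)) -> forall x, Y (P x) = P (Y x).
Proof.
move=> [_ _ sP] XY cX x; apply: dotp_injr => z.
by rewrite -XY -sP -sP -XY cX.
Qed.

End BoundedOperators.

(** * Contractions given on a dense set *)

Section Extension.
Variables (R : realType) (V W : hilbertType R).
(** A graph instead of a function: a vector has many representations as a sum of tensors, and the
    bound [Gbnd], applied to a difference of two pairs, shows that the value does not depend on the
    representation. *)
Variable G : V -> W -> Prop.
Hypothesis Glin : forall (a : R[i]) x x' y y', G x y -> G x' y' ->
  G (a *: x + x') (a *: y + y').
Hypothesis Gbnd : forall x y, G x y -> nrm y <= nrm x.
Hypothesis Gdense : dense [set x | exists y, G x y].

Let Gc x y := forall eps : R, 0 < eps ->
  exists x' y', [/\ G x' y', nrm (x - x') < eps & nrm (y - y') < eps].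

Let GB x y x' y' : G x y -> G x' y' -> G (x - x') (y - y').
Proof.
by move=> h /(Glin (-1)) /(_ h); rewrite !scaleN1r ![- _ + _]addrC.
Qed.

Let Gc_total x : exists y, Gc x y.
Proof.
have inv0 n : 0 < n.+1%:R^-1 :> R by rewrite invr_gt0 ltr0n.
have /choice[f fP] n : exists p : V * W, G p.1 p.2 /\ nrm (x - p.1) < n.+1%:R^-1.
  by have [x' [y' xy'] xx'] := denseP Gdense x (inv0 n); exists (x', y').
have small (eps : R) : 0 < eps -> exists N, forall n, (N <= n)%N -> n.+1%:R^-1 < eps.
  move=> e0; have [N _ NP] := near_infty_natSinv_lt (PosNum e0).
  by exists N => n Nn; exact: NP.
have [eps e0|y yP] := cauchy_lim (u := fun n => (f n).2).
  have [N NP] := small (eps / 2) ltac:(lra).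
  exists N => m n Nm Nn.
  apply: le_lt_trans (Gbnd (GB (fP m).1 (fP n).1)) _.
  rewrite (_ : _ - _ = (x - (f n).1) - (x - (f m).1)); last first.
    by rewrite opprB addrCA addrAC subrr add0r.
  apply: le_lt_trans (nrmB _ _) _.
  have hm := lt_trans (fP m).2 (NP _ Nm); have hn := lt_trans (fP n).2 (NP _ Nn).
  by rewrite [eps]splitr ltrD.
exists y => eps e0; have [N NP] := small _ e0; have [N' NP'] := yP _ e0.
exists (f (maxn N N')).1, (f (maxn N N')).2; split.
- by have [] := fP (maxn N N').
- by apply: lt_trans (fP _).2 _; apply: NP; exact: leq_maxl.
- by apply: NP'; exact: leq_maxr.
Qed.

Let Gc_lin (a : R[i]) x x' y y' : Gc x y -> Gc x' y' ->
  Gc (a *: x + x') (a *: y + y').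
Proof.
(* The summand 1 keeps [M] positive when [a] is 0, so that [eps / (2 * M)] is an admissible
   tolerance. *)
move=> h h' eps e0; pose M := complex.Re `|a| + 1.
have ME : complex.Re `|a| = M - 1 by rewrite /M addrK.
have a0 : 0 <= complex.Re `|a| by rewrite -ler0c RRe_real ?normr_real ?normr_ge0.
have M0 : 0 < M by rewrite /M; lra.
have [z [w [zw xz yw]]] := h (eps / (2 * M)) ltac:(by rewrite divr_gt0//; lra).
have [z' [w' [zw' xz' yw']]] := h' (eps / 2) ltac:(lra).
have key (T : hilbertType R) (p q p' q' : T) : nrm (p - q) < eps / (2 * M) ->
    nrm (p' - q') < eps / 2 -> nrm ((a *: p + p') - (a *: q + q')) < eps.
  move=> pq pq'; rewrite opprD addrACA -scalerBr.
  apply: le_lt_trans (nrmD _ _) _; rewrite nrmZ.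
  have : complex.Re `|a| * nrm (p - q) <= eps / 2.
    have : M * nrm (p - q) <= M * (eps / (2 * M)) by rewrite ler_pM2l// ltW.
    have -> : M * (eps / (2 * M)) = eps / 2 by field; rewrite gt_eqF.
    by apply: le_trans; rewrite ler_wpM2r ?nrm_ge0// ME; lra.
  lra.
exists (a *: z + z'), (a *: w + w'); split; [exact: Glin|exact: key|exact: key].
Qed.

Let Gc_bnd x y : Gc x y -> nrm y <= nrm x.
Proof.
move=> h; apply/ler_addgt0Pl => eps e0.
have [x' [y' [xy' xx' yy']]] := h (eps / 2) ltac:(lra).
have := Gbnd xy'; have := nrmD (y - y') y'; have := nrmD (x' - x) x.
rewrite !subrK nrmC; lra.
Qed.

Let G_Gc x y : G x y -> Gc x y.
Proof. by move=> h eps e0; exists x, y; rewrite !subrr !nrm0. Qed.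

Let Gc_fun x y y' : Gc x y -> Gc x y' -> y = y'.
Proof.
move=> h /(Gc_lin (-1)) /(_ h); rewrite !scaleN1r addNr => /Gc_bnd.
rewrite nrm0 => n0; apply/eqP; rewrite -subr_eq0 addrC; apply/eqP/nrm_eq0/eqP.
by rewrite eq_le n0 nrm_ge0.
Qed.

(* T is the operator whose graph is the closure of G. *)
Lemma dense_extension : exists T : V -> W,
  [/\ linear T, forall x, nrm (T x) <= nrm x & forall x y, G x y -> T x = y].
Proof.
have /choice[T TP] := Gc_total; exists T; split.
- by move=> a x y; apply: Gc_fun (TP _) _; exact: Gc_lin.
- by move=> x; exact: Gc_bnd.
- by move=> x y /G_Gc h; apply: Gc_fun (TP _) _.
Qed.

End Extension.

(** * Lebesgue differentiation *)

#[local] Instance ae_lebesgue_filter (R : realType) :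
  Filter (nbhs (almost_everywhere (@lebesgue_measure R))).
Proof. exact: (ae_filter_ringOfSetsType (@lebesgue_measure R)). Qed.

Section Locality.
Variable R : realType.
Notation mu := (@lebesgue_measure R).
Notation I01 := (`[0, 1]%classic : set R).

(** Taking a = t and b = t + h and dividing by h gives |F'(t)| <= eps G'(t) as h decreases to 0;
    G'(t) is finite and eps is arbitrary. Right-hand difference quotients suffice because both
    derivatives exist. *)
Lemma derive1_local0 (F G : R -> R) (t : R) :
  derivable F t 1 -> derivable G t 1 ->
  (forall eps : R, 0 < eps -> exists u v, [/\ u < t, t < v &
     forall a b, u < a -> a <= b -> b < v -> `|F b - F a| <= eps * (G b - G a)]) ->
  derive1 F t = 0.
Proof.
move=> dF dG loc.
have quot (H : R -> R) : derivable H t 1 ->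
    h^-1 *: (H (h + t) - H t) @[h --> 0^'+] --> derive1 H t.
  rewrite /derivable /derive1; set X := (X in cvg (X @ _)).
  have -> : X = (fun h => h^-1 *: (H (h + t) - H t)).
    by apply/funext => h; rewrite /X /= [h%:A]mulr1.
  exact: cvg_dnbhs_at_right.
have small (e : R) : 0 < e -> `|derive1 F t| <= e + e * (`|derive1 G t| + e).
  move=> e0; have [u [v [ut tv uv]]] := loc e e0.
  have /cvgrPdist_lt/(_ e e0) cF := quot F dF.
  have /cvgrPdist_lt/(_ e e0) cG := quot G dG.
  have [h [h0 hv hF hG]] : exists h : R, [/\ 0 < h, h < v - t,
      `|derive1 F t - h^-1 *: (F (h + t) - F t)| < e &
      `|derive1 G t - h^-1 *: (G (h + t) - G t)| < e].
    near (0 : R)^'+ => h; exists h; split.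
    - by near: h; exact: nbhs_right_gt.
    - by near: h; apply: nbhs_right_lt; rewrite subr_gt0.
    - by near: h; exact: cF.
    - by near: h; exact: cG.
  have := uv t (h + t) ut ltac:(lra) ltac:(lra).
  set dF' := F (h + t) - F t in hF *; set dG' := G (h + t) - G t in hG *.
  rewrite -(ler_pM2l (x := h^-1)) ?invr_gt0// mulrCA => le1.
  have : `|h^-1 *: dF'| <= e * (h^-1 *: dG') by rewrite normrZ gtr0_norm ?invr_gt0.
  have h1 := ler_normD (derive1 F t - h^-1 *: dF') (h^-1 *: dF').
  rewrite subrK in h1; have h2 := ler_norm (derive1 G t).
  move: hG; rewrite ltr_distl => /andP[hG _].
  have : e * (h^-1 *: dG') <= e * (`|derive1 G t| + e).
    by rewrite ler_pM2l//; lra.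
  lra.
apply/normr0_eq0/eqP; rewrite eq_le normr_ge0 andbT.
apply/ler_addgt0Pl => d d0; rewrite addr0.
set c := `|derive1 G t| in small.
have c0 : 0 <= c by exact: normr_ge0.
(* Since e <= 1, the bound e + e (c + e) is at most e (c + 2), hence at most d. *)
pose e := Num.min 1 (d / (c + 2)).
have e0 : 0 < e by rewrite /e lt_min ltr01 divr_gt0//; lra.
apply: le_trans (small e e0) _.
have e1 : e <= 1 by rewrite /e ge_min lexx.
have : e * (c + 2) <= d by rewrite -ler_pdivlMr ?/e ?ge_min ?lexx ?orbT//; lra.
by apply: le_trans; nra.
Unshelve. all: by end_near.
Qed.

Lemma locally_dominated_ae0 (f g : R -> R) :
  mu.-integrable I01 (EFin \o f) -> mu.-integrable I01 (EFin \o g) ->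
  (\forall t \ae mu, 0 < t < 1 ->
    forall eps : R, 0 < eps -> exists u v, [/\ u < t, t < v &
     forall a b, u < a -> a <= b -> b < v -> 0 <= a -> b <= 1 ->
     `|(\int[mu]_(x in `[0%R, b]) f x) - \int[mu]_(x in `[0%R, a]) f x| <=
      eps * ((\int[mu]_(x in `[0%R, b]) g x) - \int[mu]_(x in `[0%R, a]) g x)]) ->
  ae_eq mu I01 f (cst 0).
Proof.
move=> If Ig loc.
have mI : measurable I01 by exact: measurable_itv.
have ext (h : R -> R) : mu.-integrable I01 (EFin \o h) ->
    {ae mu, forall t, 0 < t < 1 ->
      let H x := \int[mu]_(s in `[0, x]) (h \_ I01) s in
      derivable H t 1 /\ derive1 H t = h t}.
  move=> Ih.
  have Ih0 : mu.-integrable setT (EFin \o (h \_ I01)).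
    by have := Ih; rewrite integrable_mkcond// restrict_EFin.
  have Ihy y : mu.-integrable `[0, y] (EFin \o (h \_ I01)).
    by apply: integrableS Ih0.
  have := @FTC1 R (h \_ I01) (BLeft 0).
  move=> /(_ Ihy (integrable_locally mI Ih)).
  apply: filterS => t + /andP[t0 t1].
  move=> /(_ _)/=; rewrite lte_fin => /(_ t0) [dH ->]; split => //.
  by rewrite patchE mem_set//= in_itv/= !ltW.
have intE (h : R -> R) b : b <= 1 ->
    \int[mu]_(s in `[0, b]) (h \_ I01) s = \int[mu]_(s in `[0, b]) h s.
  move=> b1; apply: eq_Rintegral => x; rewrite inE/= in_itv/= => /andP[x0 xb].
  by rewrite patchE mem_set//= in_itv/= x0 (le_trans xb).
have end_ae (r : R) : {ae mu, forall t, t <> r}.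
  exists [set r]; split; [exact: measurable_set1|exact: lebesgue_measure_set1|].
  by move=> t /= /contrapT.
have inner : {ae mu, forall t, I01 t -> 0 < t < 1}.
  have := end_ae 0; have := end_ae 1; apply: filterS2 => t t1 t0.
  rewrite /= in_itv/= => /andP[t0' t1'].
  by rewrite !lt_neqAle t0' t1' !andbT; apply/andP; split; apply/eqP => // /esym.
suff : {ae mu, forall t, 0 < t < 1 -> f t = 0}.
  by move: inner; apply: filterS2 => t h ft /h /ft.
move: (ext _ If) (ext _ Ig) loc; apply: filterS3 => t df dg loc t01.
have [dG _] := dg t01; have [dF <-] := df t01.
apply: derive1_local0 dF dG _ => eps e0.
have [u [v [ut tv uv]]] := loc t01 eps e0; have /andP[tt0 tt1] := t01.
(* The domination is assumed between points of [0, 1] only, so the window is cut down to the unit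
   interval. *)
exists (Num.max u 0), (Num.min v 1); split; rewrite ?gt_max ?lt_min ?ut ?tv//.
move=> a b; rewrite gt_max lt_min => /andP[ua a0] ab /andP[bv b1].
rewrite !intE ?(ltW b1) ?(le_trans ab (ltW b1))//.
by apply: uv => //; exact: ltW.
Qed.

End Locality.

(** * Square integrable functions on [0,1] *)

Section SquareIntegrable.
Variable R : realType.
Notation mu := (@lebesgue_measure R).
Notation I01 := (`[0, 1]%classic : set R).
Implicit Types f g : R -> R[i].

Lemma Re_indicM (A : set R) x (z : R[i]) :
  complex.Re (\1_A x * z) = \1_A x * complex.Re z.
Proof. by rewrite !indicE; case: (x \in A); rewrite ?mul1r ?mul0r. Qed.

Lemma Im_indicM (A : set R) x (z : R[i]) :
  complex.Im (\1_A x * z) = \1_A x * complex.Im z.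
Proof. by rewrite !indicE; case: (x \in A); rewrite ?mul1r ?mul0r. Qed.

Lemma ReM (z w : R[i]) :
  complex.Re (z * w) = complex.Re z * complex.Re w - complex.Im z * complex.Im w.
Proof. by case: z; case: w. Qed.

Lemma ImM (z w : R[i]) :
  complex.Im (z * w) = complex.Re z * complex.Im w + complex.Im z * complex.Re w.
Proof. by case: z; case: w. Qed.

Lemma ReJ (z : R[i]) : complex.Re z^*%R = complex.Re z.
Proof. by case: z. Qed.

Lemma ImJ (z : R[i]) : complex.Im z^*%R = - complex.Im z.
Proof. by case: z. Qed.

Lemma ReD (z w : R[i]) : complex.Re (z + w) = complex.Re z + complex.Re w.
Proof. by case: z; case: w. Qed.

Lemma ImD (z w : R[i]) : complex.Im (z + w) = complex.Im z + complex.Im w.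
Proof. by case: z; case: w. Qed.

Lemma dominated_integrable (h k : R -> R) : measurable_fun I01 h ->
  mu.-integrable I01 (EFin \o k) -> (forall x, `|h x| <= k x) ->
  mu.-integrable I01 (EFin \o h).
Proof.
move=> mh Ik hk; apply: le_integrable Ik => //.
- exact/measurable_EFinP.
- by move=> x _ /=; rewrite lee_fin (le_trans (hk x))// ler_norm.
Qed.

Lemma sqi_lin (a : R[i]) f g : square_integrable f -> square_integrable g ->
  square_integrable (fun x => a * f x + g x).
Proof.
move=> [mRf mIf If] [mRg mIg Ig].
have mR : measurable_fun I01 (fun x => complex.Re (a * f x + g x)).
  under [X in measurable_fun _ X]eq_fun do rewrite ReD ReM.
  apply: measurable_funD => //; apply: measurable_funB;
    exact: (measurable_funM (measurable_cst _)).
have mI : measurable_fun I01 (fun x => complex.Im (a * f x + g x)).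
  under [X in measurable_fun _ X]eq_fun do rewrite ImD ImM.
  apply: measurable_funD => //; apply: measurable_funD;
    exact: (measurable_funM (measurable_cst _)).
split=> //.
(* The dominating function is 2 |a f|^2 + 2 |g|^2, which exceeds |a f + g|^2 by |a f - g|^2. *)
pose A := 2 * (complex.Re a ^+ 2 + complex.Im a ^+ 2).
pose F x := complex.Re (f x) ^+ 2 + complex.Im (f x) ^+ 2.
pose G x := complex.Re (g x) ^+ 2 + complex.Im (g x) ^+ 2.
apply: (@dominated_integrable _ (fun x => A * F x + 2 * G x)).
- by apply: measurable_funD; apply: measurable_funX.
- apply: (@integrableD _ _ _ mu _ _ (fun x => (A * F x)%:E) (fun x => (2 * G x)%:E)).
  + exact: measurable_itv.
  + exact: (@integrableZl _ _ _ mu _ _ A (EFin \o F)).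
  + exact: (@integrableZl _ _ _ mu _ _ 2 (EFin \o G)).
move=> x; rewrite ger0_norm ?addr_ge0 ?sqr_ge0//.
rewrite ReD ImD ReM ImM /A /F /G.
move: (complex.Re a) (complex.Im a) (complex.Re (f x)) (complex.Im (f x))
  (complex.Re (g x)) (complex.Im (g x)) => p q r s t u.
have := sqr_ge0 (p * r - q * s - t); have := sqr_ge0 (p * s + q * r - u); lra.
Qed.

Lemma sqi_indic (A : set R) f : measurable A -> square_integrable f ->
  square_integrable (fun x => \1_A x * f x).
Proof.
move=> mA [mR mI If]; split.
- under [X in measurable_fun _ X]eq_fun do rewrite Re_indicM.
  by apply: measurable_funM => //; exact: measurable_indic.
- under [X in measurable_fun _ X]eq_fun do rewrite Im_indicM.
  by apply: measurable_funM => //; exact: measurable_indic.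
- apply: dominated_integrable If _.
  + under [X in measurable_fun _ X]eq_fun do rewrite Re_indicM Im_indicM.
    by apply: measurable_funD; apply: measurable_funX;
      apply: measurable_funM => //; exact: measurable_indic.
  + move=> x; rewrite ger0_norm ?addr_ge0 ?sqr_ge0//.
    rewrite Re_indicM Im_indicM indicE; case: (x \in A); rewrite ?mul1r//.
    by rewrite !mul0r expr0n addr0 addr_ge0 ?sqr_ge0.
Qed.

Lemma sqi_conj f : square_integrable f -> square_integrable (fun x => (f x)^*%R).
Proof.
move=> [mR mI If]; split.
- by under [X in measurable_fun _ X]eq_fun do rewrite ReJ.
- by under [X in measurable_fun _ X]eq_fun do rewrite ImJ; exact: measurable_funN.
- by under [X in _.-integrable _ X]eq_fun do rewrite ReJ ImJ sqrrN.
Qed.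

Lemma sqi_cst (c : R[i]) : square_integrable (fun=> c).
Proof.
split; [exact: measurable_cst|exact: measurable_cst|].
apply/integrableP; split; first exact: measurable_cst.
rewrite integral_cst//=.
by rewrite lebesgue_measure_itv/= lte_fin ltr01 oppr0 adde0 mule1 ltry.
Qed.

(** Both parts of f g are dominated by |f|^2 + |g|^2, by expanding squares of sums and differences
    of the coordinates. *)
Lemma sqi_mul f g : square_integrable f -> square_integrable g ->
  mu.-integrable I01 (EFin \o (fun x => complex.Re (f x * g x))) /\
  mu.-integrable I01 (EFin \o (fun x => complex.Im (f x * g x))).
Proof.
move=> [mRf mIf If] [mRg mIg Ig].
pose F x := complex.Re (f x) ^+ 2 + complex.Im (f x) ^+ 2.
pose G x := complex.Re (g x) ^+ 2 + complex.Im (g x) ^+ 2.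
have IFG : mu.-integrable I01 (EFin \o (fun x => F x + G x)).
  apply: (@integrableD _ _ _ mu _ _ (fun x => (F x)%:E) (fun x => (G x)%:E)).
  - exact: measurable_itv.
  - exact: If.
  - exact: Ig.
have sq (z : R) : 0 <= z ^+ 2 by exact: sqr_ge0.
split; apply: dominated_integrable IFG _.
- under [X in measurable_fun _ X]eq_fun do rewrite ReM.
  by apply: measurable_funB; apply: measurable_funM.
- move=> x; rewrite ReM /F /G.
  move: (complex.Re (f x)) (complex.Im (f x)) (complex.Re (g x)) (complex.Im (g x)).
  move=> p q r s; have := (sq p, sq q, sq r, sq s); move=> [[[? ?] ?] ?].
  rewrite ler_norml; apply/andP; split.
  + have := sq (p + r); have := sq (q - s); lra.
  + have := sq (p - r); have := sq (q + s); lra.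
- under [X in measurable_fun _ X]eq_fun do rewrite ImM.
  by apply: measurable_funD; apply: measurable_funM.
- move=> x; rewrite ImM /F /G.
  move: (complex.Re (f x)) (complex.Im (f x)) (complex.Re (g x)) (complex.Im (g x)).
  move=> p q r s; have := (sq p, sq q, sq r, sq s); move=> [[[? ?] ?] ?].
  rewrite ler_norml; apply/andP; split.
  + have := sq (p + s); have := sq (q + r); lra.
  + have := sq (p - s); have := sq (q - r); lra.
Qed.

Lemma Rintegral_indic01 (h : R -> R) (b : R) : b <= 1 ->
  \int[mu]_(x in I01) (\1_`[0%R, b] x * h x) = \int[mu]_(x in `[0%R, b]) h x.
Proof.
move=> b1; have -> : `[0, b]%classic = I01 `&` (`[0, b]%classic : set R).
  rewrite eqEsubset; split => x; last by case.
  rewrite /= !in_itv/= => /andP[x0 xb]; split; last by rewrite x0.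
  by rewrite x0 (le_trans xb).
rewrite Rintegral_mkcondr; apply: eq_Rintegral => x xI.
rewrite indicE patchE in_setI xI.
by case: (x \in _); rewrite ?mul1r ?mul0r.
Qed.

Lemma integral01_indic f (b : R) : b <= 1 ->
  integral01 (fun x => \1_`[0%R, b] x * f x) =
  (\int[mu]_(x in `[0%R, b]) complex.Re (f x)) +i*
  (\int[mu]_(x in `[0%R, b]) complex.Im (f x)).
Proof.
move=> b1; rewrite -(Rintegral_indic01 (fun x => complex.Re (f x)) b1).
rewrite -(Rintegral_indic01 (fun x => complex.Im (f x)) b1); congr (_ +i* _);
  by apply: eq_Rintegral => x _; rewrite ?Re_indicM ?Im_indicM.
Qed.

End SquareIntegrable.

(** * Multiplication operators on L^2[0,1] *)

Section L2Space.
Variables (R : realType) (H : hilbertType R) (U : (R -> R[i]) -> H).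
Hypothesis hU : L2_unitary U.
Notation mu := (@lebesgue_measure R).
Notation I01 := (`[0, 1]%classic : set R).
Notation M t := (mul_indic U `[0, t]%classic).
Implicit Types f g : R -> R[i].

Lemma U_surj h : exists2 f, square_integrable f & U f = h.
Proof. by case: hU. Qed.

Lemma U_dot f g : square_integrable f -> square_integrable g ->
  '<U f, U g> = integral01 (fun x => f x * (g x)^*).
Proof. by case: hU => _ + _; exact. Qed.

Lemma U_lin (a : R[i]) f g : square_integrable f -> square_integrable g ->
  U (fun x => a * f x + g x) = a *: U f + U g.
Proof. by case: hU => + _ _; exact. Qed.

Lemma integral01_ae0 f : ae_eq mu I01 (fun x => complex.Re (f x)) (cst 0) ->
  ae_eq mu I01 (fun x => complex.Im (f x)) (cst 0) ->
  measurable_fun I01 (fun x => complex.Re (f x)) ->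
  measurable_fun I01 (fun x => complex.Im (f x)) -> integral01 f = 0.
Proof.
move=> Re0 Im0 mRe mIm; rewrite /integral01.
have int0 (h : R -> R) : ae_eq mu I01 h (cst 0) -> measurable_fun I01 h ->
    \int[mu]_(x in I01) h x = 0.
  move=> h0 mh; rewrite /Rintegral (ae_eq_integral (cst 0%E))//.
  - by rewrite integral0.
  - exact/measurable_EFinP.
  - by move: h0; apply: filterS => x h0 /h0 /= ->.
by rewrite (int0 (fun x => complex.Re (f x)))// (int0 (fun x => complex.Im (f x))).
Qed.

(** The inner product with any U h sees everything; the real factor 1_A moves onto h, after which f
    enters through U f alone. This makes the choice inside [mul_indic] harmless. *)
Lemma U_indic_indep (A : set R) f g : measurable A -> square_integrable f ->
  square_integrable g -> U f = U g ->
  U (fun x => \1_A x * f x) = U (fun x => \1_A x * g x).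
Proof.
move=> mA sf sg fg.
have sA h : square_integrable h -> square_integrable (fun x => \1_A x * h x).
  exact: sqi_indic.
apply: dotp_inj => z; have [h sh <-] := U_surj z.
rewrite !U_dot//; [|exact: sA|exact: sA].
have move_indic k : integral01 (fun x => (\1_A x * k x) * (h x)^*) =
    integral01 (fun x => k x * (\1_A x * h x)^*).
  congr integral01; apply/funext => x; rewrite rmorphM /= -mulrA mulrCA.
  by rewrite indicE rmorph_nat.
by rewrite !move_indic -!U_dot ?fg//; exact: sA.
Qed.

Lemma mul_indicE (A : set R) f : measurable A -> square_integrable f ->
  mul_indic U A (U f) = U (fun x => \1_A x * f x).
Proof.
move=> mA sf; rewrite /mul_indic; case: xgetP => [g _ [sg gf]|/(_ f)].
  by apply: U_indic_indep.
by case.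
Qed.

Lemma mul_indic_proj (A : set R) : measurable A -> projection (mul_indic U A).
Proof.
move=> mA; split.
- move=> a h k; have [f sf <-] := U_surj h; have [g sg <-] := U_surj k.
  rewrite -U_lin// !mul_indicE//; last exact: sqi_lin.
  rewrite -U_lin; [|exact: sqi_indic|exact: sqi_indic].
  by congr U; apply/funext => x; rewrite mulrDr mulrCA.
- move=> h; have [f sf <-] := U_surj h.
  rewrite !mul_indicE//; last exact: sqi_indic.
  congr U; apply/funext => x; rewrite indicE.
  by case: (x \in A); rewrite ?mul1r ?mul0r.
- move=> h k; have [f sf <-] := U_surj h; have [g sg <-] := U_surj k.
  rewrite !mul_indicE// !U_dot//; [|exact: sqi_indic|exact: sqi_indic].
  congr integral01; apply/funext => x; rewrite rmorphM /= -mulrA mulrCA.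
  by rewrite indicE rmorph_nat.
Qed.

Lemma mul_indicI (A B : set R) h : measurable A -> measurable B ->
  mul_indic U A (mul_indic U B h) = mul_indic U (A `&` B) h.
Proof.
move=> mA mB; have [f sf <-] := U_surj h.
rewrite !mul_indicE//; [|exact: measurableI|exact: sqi_indic].
by congr U; apply/funext => x; rewrite indicI mulrA.
Qed.

Lemma mul_indic_nest (s t : R) h : s <= t ->
  M s (M t h) = M s h /\ M t (M s h) = M s h.
Proof.
move=> st; have mI r : measurable (`[0, r]%classic : set R) by exact: measurable_itv.
have sub : (`[0, s]%classic : set R) `<=` `[0, t]%classic.
  by move=> x /=; rewrite !in_itv/= => /andP[-> /le_trans]; exact.
rewrite !mul_indicI//; split; congr mul_indic.
- exact: setIidl.
- exact: setIidr.
Qed.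

Lemma dot_mul_indic h k f g t : square_integrable f -> square_integrable g ->
  h = U f -> k = U g -> t <= 1 ->
  '<M t h, k> = (\int[mu]_(x in `[0%R, t]) complex.Re (f x * (g x)^*)) +i*
                (\int[mu]_(x in `[0%R, t]) complex.Im (f x * (g x)^*)).
Proof.
move=> sf sg -> -> t1; rewrite mul_indicE// U_dot//; last exact: sqi_indic.
rewrite -integral01_indic//; congr integral01; apply/funext => x.
by rewrite mulrA.
Qed.

(** If h, k, g1, g2 come from f, g, p, q, then <M_t h, k> is the integral of f times the conjugate
    of g over [0,t], and |M_t g1|^2 + |M_t g2|^2 that of |p|^2 + |q|^2. Nestedness of M_a and M_b
    turns the squared norms of differences into increments of the latter. *)
Lemma locally_dominated_dot0 (h k g1 g2 : H) :
  (\forall t \ae mu, 0 < t < 1 -> forall eps : R, 0 < eps ->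
    exists u v, [/\ u < t, t < v & forall a b, u < a -> a <= b -> b < v ->
      0 <= a -> b <= 1 ->
      `|'<M b h - M a h, k>| <=
         (eps * (nrm (M b g1 - M a g1) ^+ 2 + nrm (M b g2 - M a g2) ^+ 2))%:C]) ->
  '<h, k> = 0.
Proof.
have [f sf <-] := U_surj h; have [g sg <-] := U_surj k.
have [p sp <-] := U_surj g1; have [q sq <-] := U_surj g2.
have [IRe IIm] := sqi_mul sf (sqi_conj sg).
have [Ip _] := sqi_mul sp (sqi_conj sp); have [Iq _] := sqi_mul sq (sqi_conj sq).
pose D x := complex.Re (p x * (p x)^*) + complex.Re (q x * (q x)^*).
have ID : mu.-integrable I01 (EFin \o D).
  apply: (@integrableD _ _ _ mu _ _ (fun x => (complex.Re (p x * (p x)^*))%:E)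
    (fun x => (complex.Re (q x * (q x)^*))%:E)).
  - exact: measurable_itv.
  - exact: Ip.
  - exact: Iq.
have sub01 (F : R -> R) b : b <= 1 -> mu.-integrable I01 (EFin \o F) ->
    mu.-integrable `[0, b] (EFin \o F).
  move=> b1; apply: integrableS => //.
  by move=> x /=; rewrite !in_itv/= => /andP[-> /le_trans]; exact.
move=> loc.
have normD a b : a <= b -> b <= 1 ->
    nrm (M b (U p) - M a (U p)) ^+ 2 + nrm (M b (U q) - M a (U q)) ^+ 2 =
    \int[mu]_(x in `[0, b]) D x - \int[mu]_(x in `[0, a]) D x.
  move=> ab b1; have a1 := le_trans ab b1.
  have nrm_gap w r : square_integrable w -> r = U w ->
      nrm (M b r - M a r) ^+ 2 = \int[mu]_(x in `[0, b]) complex.Re (w x * (w x)^*) -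
        \int[mu]_(x in `[0, a]) complex.Re (w x * (w x)^*).
    move=> sw rw; apply: complexI; rewrite -dotpp.
    have [mI1 mI2] : projection (M a) /\ projection (M b).
      by split; apply: mul_indic_proj; exact: measurable_itv.
    have [[_ aa sa] [_ bb sb]] := (mI1, mI2).
    rewrite dotpBl !dotpBr -!sb -!sa aa bb.
    have [-> ->] := mul_indic_nest r ab; rewrite subrr subr0.
    rewrite (dot_mul_indic sw sw rw rw b1) (dot_mul_indic sw sw rw rw a1).
    apply/eqP; rewrite eq_complex /= eqxx /=.
    have -> : (fun x => complex.Im (w x * (w x)^*)) = cst 0.
      by apply/funext => x; rewrite ImM ReJ ImJ /=; ring.
    by rewrite !Rintegral_cst ?mul0r ?subrr//; exact: measurable_itv.
  rewrite (nrm_gap p)// (nrm_gap q)// /D !RintegralD//;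
    try by [exact: measurable_itv | exact: sub01]; lra.
(* The differentiation lemma is about real functions; [part] stands for the real or the imaginary
   part, so that both are treated at once. *)
have dom (part : R[i] -> R) : (forall z w, part (z - w) = part z - part w) ->
    (forall z : R[i], `|part z|%:C <= `|z|) ->
    (forall r, r <= 1 -> part '<M r (U f), U g> =
       \int[mu]_(x in `[0, r]) part (f x * (g x)^*)) ->
    mu.-integrable I01 (EFin \o (fun x => part (f x * (g x)^*))) ->
    ae_eq mu I01 (fun x => part (f x * (g x)^*)) (cst 0).
  move=> partB part_le partE Ipart.
  apply: (locally_dominated_ae0 Ipart ID).
  move: loc; apply: filterS => t loc t01 eps e0.
  have [u [v [ut tv uv]]] := loc t01 eps e0.
  exists u, v; split => // a b ua ab bv a0 b1.
  rewrite -!partE ?(le_trans ab b1)// -partB -dotpBl -normD// -lecR.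
  exact: le_trans (part_le _) (uv _ _ _ _ _ _ _).
rewrite U_dot//; apply: integral01_ae0.
- apply: dom => //.
  + by case=> ? ? [].
  + exact: normc_ge_Re.
  + by move=> r r1; rewrite (dot_mul_indic sf sg).
- apply: dom => //.
  + by case=> ? ? [].
  (* Up to sign, the imaginary part of z is the real part of i z, which has the same modulus as
     z. *)
  + move=> z; have := normc_ge_Re (z * 'i%C).
    rewrite ReiNIm normrN normrM => /le_trans; apply.
    by rewrite [`|'i%C|]normc_def /= expr0n expr1n add0r sqrtr1 mulr1.
  + by move=> r r1; rewrite (dot_mul_indic sf sg).
- by have /measurable_int/measurable_EFinP := IRe.
- by have /measurable_int/measurable_EFinP := IIm.
Qed.

Notation one := (U (fun=> 1)).

(** The constant function 1 is a cyclic vector of the nest, which is the form in which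
    multiplicity-freeness is used: if f has zero integral over every [0,t], then f = 0 almost
    everywhere. *)
Lemma mul_indic_cyclic h :
  (forall t, 0 <= t <= 1 -> '<h, M t one> = 0) -> h = 0.
Proof.
have [f sf <-] := U_surj h => h0.
have s1 := @sqi_cst R 1.
have [IRe IIm] := sqi_mul sf (sqi_conj s1).
have M0 t : 0 <= t <= 1 -> '<M t (U f), one> = 0.
  have [_ _ sM] : projection (M t) by apply: mul_indic_proj; exact: measurable_itv.
  by move=> t01; rewrite sM h0.
have zero (part : R[i] -> R) : part 0 = 0 ->
    (forall r, r <= 1 -> part '<M r (U f), one> =
       \int[mu]_(x in `[0, r]) part (f x * 1^*)) ->
    mu.-integrable I01 (EFin \o (fun x => part (f x * 1^*))) ->
    ae_eq mu I01 (fun x => part (f x * 1^*)) (cst 0).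
  (* All increments of the indefinite integral vanish, so the function may serve as its own
     dominating function. *)
  move=> part0 partE Ipart; apply: (locally_dominated_ae0 Ipart Ipart).
  apply: aeW => t /andP[t0 t1] eps e0; exists 0, 1; split => // a b a0 ab b1 _ _.
  rewrite -!partE ?(ltW b1) ?(le_trans ab (ltW b1))// !M0.
  - by rewrite part0 subrr normr0 mulr0.
  - by rewrite (ltW a0) (le_trans ab (ltW b1)).
  - by rewrite (ltW b1) (le_trans (ltW a0) ab).
have := zero _ _ _ IRe; have := zero _ _ _ IIm.
move=> /(_ erefl) Im0 /(_ erefl) Re0.
have {}Re0 := Re0 (fun r r1 => f_equal _ (dot_mul_indic sf s1 erefl erefl r1)).
have {}Im0 := Im0 (fun r r1 => f_equal _ (dot_mul_indic sf s1 erefl erefl r1)).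
apply: dotp_inj => k; have [g sg <-] := U_surj k; rewrite dotp0l U_dot//.
have [JRe JIm] := sqi_mul sf (sqi_conj sg).
have f0 : {ae mu, forall x, I01 x -> f x = 0}.
  move: Re0 Im0; apply: filterS2 => x Re0 Im0 xI.
  have := Re0 xI; have := Im0 xI; rewrite rmorph1 mulr1 /=.
  by case: (f x) => ? ? /= -> ->.
apply: integral01_ae0.
- by move: f0; apply: filterS => x /[apply] ->; rewrite mul0r.
- by move: f0; apply: filterS => x /[apply] ->; rewrite mul0r.
- by have /measurable_int/measurable_EFinP := JRe.
- by have /measurable_int/measurable_EFinP := JIm.
Qed.

Definition commutes_M (A : H -> H) : Prop :=
  forall t, 0 <= t <= 1 -> forall h, A (M t h) = M t (A h).

Lemma adjoint_commutes_M A A' : is_adjoint A A' -> commutes_M A -> commutes_M A'.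
Proof.
move=> AA' cA t t01 h; apply: dotp_injr => z.
have [_ _ sM] : projection (M t) by apply: mul_indic_proj; exact: measurable_itv.
by rewrite -AA' -!sM -AA' -cA.
Qed.

(** Morally A is multiplication by f. This is not established: the formula is tested against the
    vectors M_t one, which suffices by cyclicity, and there A passes through M_t. *)
Lemma adjoint_one A A' f : is_adjoint A A' -> commutes_M A ->
  square_integrable f -> U f = A one -> A' one = U (fun x => (f x)^*).
Proof.
move=> AA' cA sf fA; have [g sg gA] := U_surj (A' one).
have s1 := @sqi_cst R 1; have sfJ := sqi_conj sf.
have mt t : measurable (`[0, t]%classic : set R) by exact: measurable_itv.
apply/eqP; rewrite -subr_eq0; apply/eqP/mul_indic_cyclic => t t01.
rewrite dotpBl; apply/eqP; rewrite subr_eq0; apply/eqP.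
rewrite dotpC -AA' cA// -fA !mul_indicE// dotpC.
have sft := sqi_indic (mt t) sf; have s1t := sqi_indic (mt t) s1.
rewrite conjCK !U_dot//; congr integral01; apply/funext => x.
by rewrite mul1r mulr1 rmorphM mulrC.
Qed.

(* For A one = U a and B one = U b, the adjoints map one to the conjugates of
   a and b, so both '<AB chi_s, chi_t> and '<BA chi_s, chi_t> are the integral
   of ab over [0,s] `&` [0,t]. *)
Lemma commutant_abelian A A' B B' h : is_adjoint A A' -> is_adjoint B B' ->
  commutes_M A -> commutes_M B -> A (B h) = B (A h).
Proof.
move=> AA' BB' cA cB.
have mt t : measurable (`[0, t]%classic : set R) by exact: measurable_itv.
have pM t : projection (M t) by exact: mul_indic_proj.
have [a sa aA] := U_surj (A one); have [b sb bB] := U_surj (B one).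
have cA' := adjoint_commutes_M AA' cA; have cB' := adjoint_commutes_M BB' cB.
have aA' := adjoint_one AA' cA sa aA; have bB' := adjoint_one BB' cB sb bB.
have sym k l : square_integrable k -> square_integrable l -> forall s t : R,
    '<M s (U k), M t (U (fun x => (l x)^*))> = '<M s (U l), M t (U (fun x => (k x)^*))>.
  move=> sk sl s t.
  have [skJ slJ] := (sqi_conj sk, sqi_conj sl).
  rewrite !mul_indicE// !U_dot//; try exact: sqi_indic.
  by congr integral01; apply/funext => x; rewrite !rmorphM /= !conjCK; ring.
have step s : 0 <= s <= 1 -> A (B (M s one)) = B (A (M s one)).
  move=> s01; apply/eqP; rewrite -subr_eq0; apply/eqP/mul_indic_cyclic => t t01.
  rewrite dotpBl (AA' (B _)) (BB' (A _)) cA'// cB'// cB// cA// aA' bB' -aA -bB sym//.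
  by rewrite subrr.
(* [step] covers the vectors M_t one only. Passing to adjoints, it makes B'A'y - A'B'y orthogonal to
   all of them for arbitrary y, hence zero by cyclicity. *)
apply: dotp_inj => y; rewrite (AA' (B h)) (BB' h) (BB' (A h)) (AA' h).
apply/eqP; rewrite -subr_eq0 -dotpBr; apply/eqP.
have -> : B' (A' y) - A' (B' y) = 0.
  apply: mul_indic_cyclic => t t01; rewrite dotpC dotpBr -BB' -!AA' -BB' step//.
  by rewrite subrr rmorph0.
by rewrite dotp0r.
Qed.

End L2Space.

(** * Tensor products *)

Section TensorOperators.
Variables (R : realType) (H K L : hilbertType R) (tens : {bilinear H -> K -> L}).
Hypothesis htens : hilbert_tensor tens.

Lemma tens_dot h k h' k' : '<tens h k, tens h' k'> = '<h, h'> * '<k, k'>.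
Proof. by case: htens. Qed.

(** Lists of pairs are formal sums: maps can be defined on them, and induction done, before it is
    known that equality in L is respected. *)
Definition tsum (s : seq (H * K)) : L := \sum_(p <- s) tens p.1 p.2.

Lemma tsum_dense (x : L) (eps : R) : 0 < eps -> exists s, nrm (x - tsum s) < eps.
Proof.
case: htens => _ /denseP dT e0; have [_ [n [h [k ->]]] xs] := dT x eps e0.
exists [seq (h i, k i) | i <- enum 'I_n].
by rewrite /tsum big_map big_enum.
Qed.

(** The density hypothesis of [dense_extension], for the graph of an arbitrary map on formal
    sums. *)
Lemma tsum_range_dense (W : Type) (f : seq (H * K) -> W) :
  dense [set x | exists y, exists s, x = tsum s /\ y = f s].
Proof.
move=> O [x Ox] oO.
have /nbhs_ballP[d d0 dO] : nbhs x O by exact: open_nbhs_nbhs.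
have dE : d = (complex.Re d)%:C by rewrite RRe_real// gtr0_real.
have [|s xs] := @tsum_dense x (complex.Re d); first by rewrite -ltcR -dE.
exists (tsum s); split; last by exists (f s), s.
by apply: dO; rewrite -ball_normE /= nrmE dE ltcR.
Qed.

(** Additivity, and not linearity, is the condition on phi, so that conjugate-linear functionals
    such as z |-> <x, z> are covered too. *)
Lemma tens_ext (phi : L -> R[i]) (C : R) :
  (forall x y, phi (x + y) = phi x + phi y) ->
  (forall x, `|phi x| <= (C * nrm x)%:C) ->
  (forall h k, phi (tens h k) = 0) -> forall x, phi x = 0.
Proof.
move=> phiD phiB phi0 x; have phi00 : phi 0 = 0.
  have /eqP := phiD 0 0.
  by rewrite addr0 -subr_eq0 opprD addrA subrr sub0r oppr_eq0 => /eqP.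
have phis s : phi (tsum s) = 0.
  by rewrite /tsum (big_morph phi phiD phi00) big1// => i _; rewrite phi0.
have C1 : 0 < `|C| + 1 by rewrite ltr_wpDl.
apply/normr0_eq0; rewrite normc_def; congr (_%:C).
set r := Num.sqrt _; apply/eqP; rewrite eq_le sqrtr_ge0 andbT.
apply/ler_addgt0Pl => eps e0; rewrite addr0.
have [s xs] := tsum_dense x (divr_gt0 e0 C1).
rewrite -lecR /r -normc_def -[x](subrK (tsum s)) phiD phis addr0.
apply: le_trans (phiB _) _; rewrite lecR.
apply: (@le_trans _ _ ((`|C| + 1) * nrm (x - tsum s))).
  by rewrite ler_wpM2r ?nrm_ge0// (le_trans (ler_norm C))// lerDl.
by rewrite mulrC -ler_pdivlMr// ltW.
Qed.

Lemma tens_dot_inj (x y : L) :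
  (forall h k, '<x, tens h k> = '<y, tens h k>) -> x = y.
Proof.
move=> xy; apply: dotp_inj => z; apply/eqP; rewrite -subr_eq0 -dotpBl; apply/eqP.
apply: (@tens_ext (fun z => '<x - y, z>) (nrm (x - y))).
- by move=> ? ?; rewrite dotpDr.
- by move=> ?; exact: dot_CS.
- by move=> h k; rewrite dotpBl xy subrr.
Qed.

Lemma eq_on_tens (T T' : L -> L) : bounded_op T -> bounded_op T' ->
  (forall h k, T (tens h k) = T' (tens h k)) -> T = T'.
Proof.
move=> [lT [c bT]] [lT' [c' bT']] TT'; apply/funext => x; apply: dotp_inj => z.
apply/eqP; rewrite -subr_eq0 -dotpBl; apply/eqP.
apply: (@tens_ext (fun x => '<T x - T' x, z>) ((c + c') * nrm z)) x.
- move=> x y /=; rewrite (linD lT) (linD lT') opprD addrACA; exact: dotpDl.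
- move=> x; apply: le_trans (dot_CS _ _) _; rewrite lecR mulrAC.
  rewrite ler_wpM2r ?nrm_ge0//; apply: le_trans (nrmB _ _) _.
  have := bT x; have := bT' x; rewrite !nrmE -!rmorphM /= !lecR mulrDl; lra.
- by move=> h k; rewrite TT' subrr dotp0l.
Qed.

Lemma tensor_opE (A : H -> H) (B : K -> K) (T : L -> L) : bounded_op T ->
  (forall h k, T (tens h k) = tens (A h) (B k)) -> tensor_op tens A B = T.
Proof.
move=> bT TAB.
have [bT' T'AB] : bounded_op (tensor_op tens A B) /\
    forall h k, tensor_op tens A B (tens h k) = tens (A h) (B k).
  exact: (@xgetPex _ (fun=> 0) [set T : L -> L | bounded_op T /\
    forall h k, T (tens h k) = tens (A h) (B k)] (ex_intro _ T (conj bT TAB))).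
by apply: eq_on_tens => // h k; rewrite T'AB TAB.
Qed.

(** On formal sums A (x) B is symmetric and idempotent because A and B are. Hence its value y at x
    satisfies <y, y> = <y, x>, so it is a contraction and extends to L. *)
Lemma tensor_projection (A : H -> H) (B : K -> K) : projection A -> projection B ->
  projection (tensor_op tens A B) /\
  forall h k, tensor_op tens A B (tens h k) = tens (A h) (B k).
Proof.
move=> [lA AA sA] [lB BB sB].
pose tsumAB s := tsum [seq (A p.1, B p.2) | p <- s].
have tsum_cons p s : tsum (p :: s) = tens p.1 p.2 + tsum s by rewrite /tsum big_cons.
have dotAB s t : '<tsumAB s, tsum t> = '<tsum s, tsumAB t>.
  rewrite /tsumAB; elim: s => [|p s IH] /=.
    by rewrite /tsum !big_nil !dotp0l.
  rewrite !tsum_cons !dotpDl IH; congr (_ + _) => {IH s}.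
  elim: t => [|q t IH] /=; first by rewrite /tsum !big_nil !dotp0r.
  by rewrite !tsum_cons !dotpDr IH !tens_dot /= sA sB.
have AB2 s : tsumAB [seq (A p.1, B p.2) | p <- s] = tsumAB s.
  by rewrite /tsumAB -map_comp; congr (tsum _); apply: eq_map => p; rewrite /= AA BB.
pose G x y := exists s, x = tsum s /\ y = tsumAB s.
have [|x y [s [-> ->]]||T [lT bT TG]] := @dense_extension R L L G.
- move=> a x x' y y' [s [-> ->]] [s' [-> ->]].
  exists ([seq (a *: p.1, p.2) | p <- s] ++ s').
  rewrite /tsumAB map_cat /tsum !big_cat /= !big_map !scaler_sumr.
  split; congr (_ + _); apply: eq_bigr => p _ /=.
    by rewrite linearZl_LR.
  by rewrite (linZ lA) linearZl_LR.
- by apply: sqr_dot_bound; rewrite {3}/tsumAB dotAB AB2 -dotAB.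
- exact: tsum_range_dense.
have Ttens h k : T (tens h k) = tens (A h) (B k).
  by apply: TG; exists [:: (h, k)]; rewrite /tsumAB /tsum /= !big_seq1.
have bdT := contraction_bounded_op lT bT.
rewrite (tensor_opE bdT Ttens); split=> //; split=> //.
- have TT : T \o T = T.
    apply: eq_on_tens => //; last by move=> h k; rewrite /= !Ttens AA BB.
    apply: contraction_bounded_op => [a u v|u /=]; first by rewrite /= !lT.
    exact: le_trans (bT _) (bT _).
  by move=> x; exact: (congr1 (@^~ x) TT).
(* The defect of self-adjointness vanishes on pairs of elementary tensors. [tens_ext] extends this
   in the first argument; the conjugate symmetry [dJ] then gives the second. *)
- pose d x y := '<T x, y> - '<x, T y>.
  have dJ x y : d x y = - (d y x)^*.
    by rewrite /d rmorphB /= -!dotpC opprB.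
  have dD y u w : d (u + w) y = d u y + d w y.
    by rewrite /d (linD lT) !dotpDl opprD addrACA.
  have db y u : `|d u y| <= (2 * nrm y * nrm u)%:C.
    apply: le_trans (ler_normB _ _) _.
    apply: le_trans (lerD (dot_CS _ _) (dot_CS _ _)) _.
    rewrite -rmorphD /= lecR.
    have := ler_wpM2l (nrm_ge0 u) (bT y).
    have := ler_wpM2r (nrm_ge0 y) (bT u); lra.
  have d0 h k x : d x (tens h k) = 0.
    apply: (tens_ext (dD _) (db _)) => h' k'.
    by rewrite /d !Ttens !tens_dot sA sB subrr.
  move=> x y; apply/eqP; rewrite -subr_eq0; apply/eqP.
  apply: (tens_ext (dD y) (db y)) => h k.
  by rewrite dJ d0 rmorph0 oppr0.
Qed.

Section BasisComponent.
Variable v : K.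
Hypothesis v1 : '<v, v> = 1.

Definition line_proj (k : K) : K := '<k, v> *: v.

Lemma line_proj_projection : projection line_proj.
Proof.
split.
- by move=> a x y; rewrite /line_proj dotpDl dotpZl scalerDl scalerA.
- by move=> x; rewrite /line_proj dotpZl v1 mulr1.
- by move=> x y; rewrite /line_proj dotpZl dotpZr -dotpC mulrC.
Qed.

Lemma nrm_tens h : nrm (tens h v) = nrm h.
Proof.
apply/eqP; rewrite -(@eqrXn2 _ 2) ?nrm_ge0//.
by rewrite -(inj_eq (@complexI R)) -!dotpp tens_dot v1 mulr1.
Qed.

(** P is the slice map sending h (x) k to <k, v> h. Extending it as a map into H, rather than the
    projection on L, shows that every value of the projection is a single elementary tensor. *)
Lemma tensor_line_range : exists P : L -> H, forall x,
  tensor_op tens id line_proj x = tens (P x) v.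
Proof.
pose G x y := exists s : seq (H * K), x = tsum s /\ y = \sum_(p <- s) '<p.2, v> *: p.1.
have [|x y [s [-> ->]]||T [lT bT TG]] := @dense_extension R L H G.
- move=> a x x' y y' [s [-> ->]] [s' [-> ->]].
  exists ([seq (a *: p.1, p.2) | p <- s] ++ s').
  rewrite /tsum !big_cat /= !big_map !scaler_sumr.
  split; congr (_ + _); apply: eq_bigr => p _ /=.
    by rewrite linearZl_LR.
  by rewrite !scalerA mulrC.
(* The vector w (x) v is the projection of the sum onto H (x) v, so its inner product with the sum
   is |w|^2. *)
- set w := \sum_(p <- s) _; rewrite -[nrm w]nrm_tens; apply: sqr_dot_bound.
  rewrite tens_dot v1 mulr1 {2}/w /tsum; elim: (s) => [|p t IH].
    by rewrite !big_nil !dotp0r.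
  by rewrite !big_cons !dotpDr IH tens_dot dotpZr -dotpC mulrC.
- exact: tsum_range_dense.
exists T => x; have lTv : linear (fun x => tens (T x) v).
  by move=> a u w; rewrite lT linearDl linearZl_LR.
rewrite (@tensor_opE _ _ (fun x => tens (T x) v))//.
  by apply: contraction_bounded_op => // u; rewrite nrm_tens.
move=> h k; rewrite (TG _ ('<k, v> *: h)); last first.
  by exists [:: (h, k)]; rewrite /tsum !big_seq1.
by rewrite /line_proj linearZl_LR linearZr_LR.
Qed.

End BasisComponent.

Variable e : nat -> K.
Hypothesis he : orthonormal_basis e.

Lemma basis_ext (x : L) : (forall h i, '<x, tens h (e i)> = 0) -> x = 0.
Proof.
move=> x0; apply: tens_dot_inj => h k; rewrite dotp0l.
have sum0 n (a : 'I_n -> R[i]) : '<x, tens h (\sum_(i < n) a i *: e i)> = 0.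
  rewrite linear_sumr dotp_sumr big1// => i _.
  by rewrite linearZr_LR dotpZr x0 mulr0.
apply/normr0_eq0; rewrite normc_def; congr (_%:C).
set r := Num.sqrt _; apply/eqP; rewrite eq_le sqrtr_ge0 andbT.
apply/ler_addgt0Pl => eps e0; rewrite addr0.
have C0 : 0 < nrm x * nrm h + 1 by rewrite ltr_wpDl// mulr_ge0 ?nrm_ge0.
have [_ [n [a ->]]] := denseP he.2 k (divr_gt0 e0 C0).
set s := \sum_(i < n) _ => ks.
rewrite -lecR /r -normc_def -[k](subrK s) linearDr dotpDr sum0 addr0.
apply: le_trans (dot_CS _ _) _; rewrite lecR.
have nt k' : nrm (tens h k') = nrm h * nrm k'.
  apply/eqP; rewrite -(@eqrXn2 _ 2) ?mulr_ge0 ?nrm_ge0//.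
  by rewrite -(inj_eq (@complexI R)) -!dotpp tens_dot exprMn rmorphM /= -!dotpp.
rewrite nt mulrA; apply: (@le_trans _ _ ((nrm x * nrm h + 1) * nrm (k - s))).
  by rewrite ler_wpM2r ?nrm_ge0// lerDl.
by rewrite mulrC -ler_pdivlMr// ltW.
Qed.

End TensorOperators.

(** * The nest *)

Section NestTheory.
Variables (R : realType) (H K L : hilbertType R) (U : (R -> R[i]) -> H).
Hypothesis hU : L2_unitary U.
Variable tens : {bilinear H -> K -> L}.
Hypothesis htens : hilbert_tensor tens.
Variable e : nat -> K.
Hypothesis he : orthonormal_basis e.
Notation mu := (@lebesgue_measure R).
Notation M t := (mul_indic U `[0, t]%classic).
Notation N := (nest_proj U tens).
Notation E := (basis_proj tens e).

Lemma e_norm1 i : '<e i, e i> = 1.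
Proof. by rewrite he.1 eqxx. Qed.

Lemma M_proj t : projection (M t).
Proof. by apply: mul_indic_proj => //; exact: measurable_itv. Qed.

Lemma N_inner t : 0 <= t <= 1 -> N t = tensor_op tens (M t) id.
Proof. by move=> /andP[t0 t1]; rewrite /nest_proj ltNge t0 ltNge t1. Qed.

Lemma N_tens t h k : 0 <= t <= 1 -> N t (tens h k) = tens (M t h) k.
Proof.
move=> t01; rewrite N_inner//.
by have [_ ->] := tensor_projection htens (M_proj t) (projection_id K).
Qed.

Lemma N_cases t : [\/ t < 0 /\ N t = (fun=> 0), 1 < t /\ N t = id | 0 <= t <= 1].
Proof.
rewrite /nest_proj; case: (ltP t 0) => t0; first by constructor 1.
by case: (ltP 1 t) => t1; [constructor 2|constructor 3].
Qed.

Lemma N_proj t : projection (N t).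
Proof.
have [[_ ->]|[_ ->]|t01] := N_cases t.
- split=> //; first by move=> a x y; rewrite scaler0 addr0.
  by move=> x y; rewrite dotp0l dotp0r.
- exact: projection_id.
- rewrite N_inner//.
  by have [] := tensor_projection htens (M_proj t) (projection_id K).
Qed.

Lemma N_mono s t x : s <= t -> N s (N t x) = N s x /\ N t (N s x) = N s x.
Proof.
move=> st.
have [[s0 Ns]|[s1 Ns]|s01] := N_cases s.
- by rewrite Ns; split=> //; have [lN _ _] := N_proj t; exact: lin0 lN.
- have t1 : 1 < t by lra.
  by have [[t0 _]|[_ ->]|t01] := N_cases t; [exfalso; lra | by rewrite Ns | exfalso; lra].
have [[t0 _]|[_ ->]|t01] := N_cases t; [exfalso; lra|by []|].
have [bs bt] := (proj_bounded (N_proj s), proj_bounded (N_proj t)).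
split.
- have -> // : N s (N t x) = (N s \o N t) x by [].
  congr (_ x); apply: (eq_on_tens htens) => //; first exact: comp_bounded.
  by move=> h k; rewrite /= !N_tens// (mul_indic_nest hU h st).1.
- have -> // : N t (N s x) = (N t \o N s) x by [].
  congr (_ x); apply: (eq_on_tens htens) => //; first exact: comp_bounded.
  by move=> h k; rewrite /= !N_tens// (mul_indic_nest hU h st).2.
Qed.

Lemma E_spec i : projection (E i) /\
  forall h k, E i (tens h k) = tens h (line_proj (e i) k).
Proof.
exact: tensor_projection (projection_id H) (line_proj_projection (e_norm1 i)).
Qed.

Lemma E_tens i j h : E i (tens h (e j)) = (i == j)%:R *: tens h (e j).
Proof.
rewrite (E_spec i).2 /line_proj he.1 eq_sym; case: eqP => [->|_].
  by rewrite !scale1r.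
by rewrite !scale0r; exact: linear0r.
Qed.

Lemma E_range i x : exists h, E i x = tens h (e i).
Proof.
have [P PE] := tensor_line_range htens (e_norm1 i).
by exists (P x); rewrite -PE.
Qed.

Lemma E_orth i j x : i != j -> E i (E j x) = 0.
Proof. by move=> ij; have [h ->] := E_range j x; rewrite E_tens (negPf ij) scale0r. Qed.

Lemma E_total x : (forall i, E i x = 0) -> x = 0.
Proof.
move=> Ex; apply: (basis_ext htens he) => h i.
have [[_ _ sE] _] := E_spec i.
have Eh : E i (tens h (e i)) = tens h (e i) by rewrite E_tens eqxx scale1r.
by rewrite -Eh -sE Ex dotp0l.
Qed.

Lemma NE_comm t i x : N t (E i x) = E i (N t x).
Proof.
have [[_ ->]|[_ ->]|t01] := N_cases t; last 2 first.
- by [].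
- have [bt be] := (proj_bounded (N_proj t), proj_bounded (E_spec i).1).
  have : N t \o E i = E i \o N t.
    apply: (eq_on_tens htens); [exact: comp_bounded|exact: comp_bounded|].
    by move=> h k; rewrite /= N_tens// !(E_spec i).2 N_tens.
  by move=> /(congr1 (@^~ x)).
by have [[lE _ _] _] := E_spec i; rewrite (lin0 lE).
Qed.

(** The compression of X to the window (u, v) has norm at most r, stated on vectors to avoid the
    infima in [opnorm] and [local_norm]. *)
Definition local_bound (t : R) (X : L -> L) (r : R) : Prop :=
  exists u v, [/\ u < t, t < v &
    forall x, nrm (N v (X (N v x - N u x)) - N u (X (N v x - N u x))) <= r * nrm x].

Lemma gap_comp a b u v x : u <= a -> a <= b -> b <= v ->
  let D x := N b x - N a x in let D' x := N v x - N u x in D' (D x) = D x.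
Proof.
move=> ua ab bv /=; have [lv _ _] := N_proj v; have [lu _ _] := N_proj u.
rewrite (linB lv) (linB lu).
rewrite (N_mono x bv).2 (N_mono x (le_trans ab bv)).2.
by rewrite (N_mono x ua).1 (N_mono x (le_trans ua ab)).1 subrr subr0.
Qed.

Lemma gap_comp_outer a b u v x : u <= a -> a <= b -> b <= v ->
  let D x := N b x - N a x in let D' x := N v x - N u x in D (D' x) = D x.
Proof.
move=> ua ab bv /=.
have [la _ _] := N_proj a; have [lb _ _] := N_proj b.
rewrite (linB lb) (linB la).
rewrite (N_mono x bv).1 (N_mono x (le_trans ab bv)).1.
by rewrite (N_mono x ua).2 (N_mono x (le_trans ua ab)).2 opprB addrA subrK.
Qed.

Lemma gap_proj a b : a <= b -> projection (fun x => N b x - N a x).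
Proof.
move=> ab; have [lb _ sb] := N_proj b; have [la _ sa] := N_proj a; split.
- by move=> c x y; rewrite lb la scalerBr opprD addrACA.
- by move=> x; apply: gap_comp.
- by move=> x y; rewrite dotpBl dotpBr sa sb.
Qed.

Lemma locally_zero_eq0 (Z : L -> L) i j : linear Z ->
  (forall t x, Z (N t x) = N t (Z x)) -> (forall x, E i (Z (E j x)) = Z x) ->
  (\forall t \ae mu, t \in `[0, 1] -> forall eps : R, 0 < eps -> local_bound t Z eps) ->
  forall x, Z x = 0.
Proof.
move=> lZ cZ EZE loc.
have [[lEi EEi sEi] _] := E_spec i; have [[_ EEj _] _] := E_spec j.
have ZE x : Z (E j x) = Z x by rewrite -EZE EEj EZE.
have EZ x : E i (Z x) = Z x by rewrite -EZE EEi.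
have zero h0 k : '<Z (tens h0 (e j)), tens k (e i)> = 0.
  have [h Zh] := E_range i (Z (tens h0 (e j))); rewrite EZ in Zh.
  rewrite Zh (tens_dot htens) e_norm1 mulr1.
  apply: (locally_dominated_dot0 hU (g1 := h0) (g2 := k)).
  move: loc; apply: filterS.
  move=> t loc /andP[t0 t1] eps e0.
  have [|u [v [ut tv uv]]] := loc _ eps e0; first by rewrite in_itv/= !ltW.
  exists u, v; split=> // a b ua ab bv a0 b1.
  have a01 : 0 <= a <= 1 by rewrite a0 (le_trans ab).
  have b01 : 0 <= b <= 1 by rewrite (le_trans a0).
  pose D x := N b x - N a x.
  have D_tens w m : D (tens w m) = tens (M b w - M a w) m.
    by rewrite /D !N_tens// linearBl.
  have [lD DD sD] : projection D := gap_proj ab.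
  have nrm_D w m : nrm (D (tens w (e m))) = nrm (M b w - M a w).
    by rewrite D_tens (nrm_tens htens (e_norm1 m)).
  (* Z commutes with D = N_b - N_a, so the increment is an entry of D Z D between vectors compressed
     to (a, b), which lies inside the window where Z is small. *)
  have -> : '<M b h - M a h, k> = '<D (Z (D (tens h0 (e j)))), D (tens k (e i))>.
    have ZD x : Z (D x) = D (Z x) by rewrite /D (linB lZ) !cZ.
    rewrite sD DD ZD sD DD -sD Zh D_tens (tens_dot htens).
    by rewrite e_norm1 mulr1.
  set X := D (tens h0 (e j)); set Y := D (tens k (e i)).
  have DX : N v X - N u X = X by apply: gap_comp => //; exact: ltW.
  have DY : N v Y - N u Y = Y by apply: gap_comp => //; exact: ltW.
  have uv' : u <= v by rewrite ltW// (lt_trans ut).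
  have bX := uv X; rewrite DX in bX.
  have -> : '<D (Z X), Y> = '<N v (Z X) - N u (Z X), Y>.
    have [_ _ ->] := gap_proj uv'; rewrite DY sD DD.
    by [].
  apply: le_trans (dot_CS _ _) _; rewrite lecR.
  rewrite -(nrm_D h0 j) -(nrm_D k i) -/X -/Y.
  (* The product of norms is replaced by the sum of their squares, since the squares have additive
     increments. *)
  apply: (@le_trans _ _ (eps * nrm X * nrm Y)).
    by rewrite ler_wpM2r ?nrm_ge0.
  rewrite -mulrA ler_wpM2l ?(ltW e0)//.
  have := sqr_ge0 (nrm X - nrm Y); have := sqr_ge0 (nrm X); have := sqr_ge0 (nrm Y).
  lra.
move=> x; apply: dotp_inj => y; rewrite dotp0l -EZ sEi -ZE.
by have [h ->] := E_range j x; have [k ->] := E_range i y; rewrite zero.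
Qed.

Definition diagonal_op (A : L -> L) : Prop :=
  [/\ linear A, forall t x, A (N t x) = N t (A x) &
      forall i x, A (E i x) = E i (A x)].

(** Each operator maps H (x) e_i to itself and acts there as an operator on H commuting with all
    M_t, so [commutant_abelian] applies. It is applied to A' and B', because testing ABx against h
    (x) e_i moves both operators onto the tensor. *)
Lemma diagonal_comm A A' B B' x : is_adjoint A A' -> is_adjoint B B' ->
  diagonal_op A -> diagonal_op A' -> diagonal_op B -> diagonal_op B' -> A (B x) = B (A x).
Proof.
move=> AA' BB' dA dA' dB dB'.
have entry T i : diagonal_op T -> exists F : H -> H,
    forall h, T (tens h (e i)) = tens (F h) (e i).
  move=> [_ _ cE].
  have /choice[F TF] h : exists w, T (tens h (e i)) = tens w (e i).
    have [w Ew] := E_range i (T (tens h (e i))).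
    by exists w; rewrite -Ew -cE E_tens eqxx scale1r.
  by exists F.
have tens_inj i h h' : tens h (e i) = tens h' (e i) -> h = h'.
  move=> hh; apply/eqP; rewrite -subr_eq0; apply/eqP/nrm_eq0.
  by rewrite -(nrm_tens htens (e_norm1 i)) linearBl hh subrr nrm0.
have entry_comm T i F : diagonal_op T ->
    (forall h, T (tens h (e i)) = tens (F h) (e i)) -> commutes_M U F.
  move=> [_ cN _] TF t t01 h; apply: (@tens_inj i).
  by rewrite -TF -N_tens// cN TF N_tens.
have entry_adj T T' i F F' : is_adjoint T T' ->
    (forall h, T (tens h (e i)) = tens (F h) (e i)) ->
    (forall h, T' (tens h (e i)) = tens (F' h) (e i)) -> is_adjoint F F'.
  move=> TT' TF TF' h k; have := TT' (tens h (e i)) (tens k (e i)).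
  by rewrite TF TF' !(tens_dot htens) e_norm1 !mulr1.
have key i h : A' (B' (tens h (e i))) = B' (A' (tens h (e i))).
  have [F AF] := entry A i dA; have [F' AF'] := entry A' i dA'.
  have [G BG] := entry B i dB; have [G' BG'] := entry B' i dB'.
  rewrite BG' AF' AF' BG'; congr (tens _ _).
  apply: (@commutant_abelian _ _ _ hU F' F G' G h).
  - by apply: adjointC; exact: entry_adj AA' AF AF'.
  - by apply: adjointC; exact: entry_adj BB' BG BG'.
  - exact: entry_comm dA' AF'.
  - exact: entry_comm dB' BG'.
apply/eqP; rewrite -subr_eq0; apply/eqP; apply: (basis_ext htens he) => h i.
by rewrite dotpBl (AA' (B x)) (BB' x) (BB' (A x)) (AA' x) key subrr.
Qed.

End NestTheory.

(** * Local norms *)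

Section OperatorNorm.
Variables (R : realType) (V : hilbertType R).
Implicit Types X : V -> V.

Lemma inf_lb0 (A : set R) : (forall r, A r -> 0 <= r) -> 0 <= inf A.
Proof.
move=> A0; have [->|An] := eqVneq A set0; first by rewrite inf0.
by apply: lb_le_inf; [exact/set0P|move=> r /A0].
Qed.

Lemma inf_le (A : set R) r : (forall s, A s -> 0 <= s) -> A r -> inf A <= r.
Proof. by move=> A0 Ar; apply: ge_inf => //; exists 0 => s /A0. Qed.

Lemma inf_lt (A : set R) r : A !=set0 -> (forall s, A s -> 0 <= s) ->
  inf A < r -> exists2 s, A s & s < r.
Proof.
move=> An A0 Ar; have hA : has_inf A by split=> //; exists 0 => s /A0.
have r0 : 0 < r - inf A by rewrite subr_gt0.
have [s As] := inf_adherent r0 hA.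
by rewrite addrC subrK => sr; exists s.
Qed.

Lemma opnorm_ge0 X : 0 <= opnorm X.
Proof. by apply: inf_lb0 => r []. Qed.

Lemma opnorm_le X r : 0 <= r -> (forall x, nrm (X x) <= r * nrm x) -> opnorm X <= r.
Proof.
move=> r0 Xr; apply: inf_le => [s []//|]; split=> // x.
by rewrite !nrmE -rmorphM lecR.
Qed.

Lemma opnorm_lt X r : bounded_op X -> opnorm X < r ->
  forall x, nrm (X x) <= r * nrm x.
Proof.
move=> /bounded_nrm[c [c0 cX]] /inf_lt[].
- by exists c; split=> // x; rewrite !nrmE -rmorphM lecR.
- by move=> s [].
move=> s [s0 sX] sr x; apply: (@le_trans _ _ (s * nrm x)).
  by rewrite -lecR rmorphM /= -!nrmE.
by rewrite ler_wpM2r ?nrm_ge0// ltW.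
Qed.

End OperatorNorm.

(** Monotonicity and the lower bound ensure convergence; for a divergent sequence [limn] is only a
    default value. *)
Lemma limn_nonincreasing0 (R : realType) (u : nat -> R) :
  (forall m n, (m <= n)%N -> u n <= u m) -> (forall n, 0 <= u n) ->
  limn u = 0 <-> forall eps, 0 < eps -> exists n, u n < eps.
Proof.
move=> u_dec u0; split.
- move=> lu eps e0.
  have cu : cvgn u.
    by apply: nonincreasing_is_cvgn => //; exists 0 => _ [n _ <-].
  move: cu => /cvgrPdist_lt/(_ eps e0)[n _ /(_ n (leqnn n))].
  by rewrite lu sub0r normrN ger0_norm//; exists n.
- move=> small; apply/cvg_lim => //; apply/cvgrPdist_lt => eps e0.
  have [n un] := small eps e0; exists n => // m /= nm.
  by rewrite sub0r normrN ger0_norm// (le_lt_trans _ un)// u_dec.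
Qed.

(** * Calculus of local bounds *)

Section LocalBounds.
Variables (R : realType) (H K L : hilbertType R) (U : (R -> R[i]) -> H).
Hypothesis hU : L2_unitary U.
Variable tens : {bilinear H -> K -> L}.
Hypothesis htens : hilbert_tensor tens.
Notation N := (nest_proj U tens).
Notation loc := (local_bound U tens).
Implicit Types X Y : L -> L.

Definition in_nest_alg X : Prop :=
  bounded_op X /\ forall t x, N t (X (N t x)) = X (N t x).

Lemma in_nest_alg_comp X Y : in_nest_alg X -> in_nest_alg Y -> in_nest_alg (X \o Y).
Proof.
move=> [bX aX] [bY aY]; split; first exact: comp_bounded.
by move=> t x /=; rewrite -aY aX.
Qed.

Lemma in_nest_alg_lin (a : R[i]) X Y : in_nest_alg X -> in_nest_alg Y ->
  in_nest_alg (fun x => a *: X x + Y x).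
Proof.
move=> [bX aX] [bY aY]; split; last first.
  by move=> t x; have [lN _ _] := N_proj hU htens t; rewrite lN aX aY.
have [lX _] := bX; have [lY _] := bY.
split.
  by move=> c x y; rewrite lX lY !scalerDr !scalerA mulrC addrACA.
have [c [_ cX]] := bounded_nrm bX; have [d [_ dY]] := bounded_nrm bY.
exists (complex.Re `|a| * c + d) => x; rewrite !nrmE -rmorphM lecR mulrDl.
apply: le_trans (nrmD _ _) _; rewrite nrmZ lerD// -mulrA ler_wpM2l//.
by rewrite -ler0c RRe_real ?normr_real.
Qed.

Lemma in_nest_alg0 : in_nest_alg (fun=> 0).
Proof.
split; last by move=> t x; have [lN _ _] := N_proj hU htens t; exact: lin0 lN.
split; first by move=> a x y; rewrite scaler0 addr0.
by exists 0 => x; rewrite normr0 mul0r.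
Qed.

Lemma in_nest_alg_proj (P : L -> L) : projection P ->
  (forall t x, N t (P x) = P (N t x)) -> in_nest_alg P.
Proof.
move=> pP cP; split; first exact: proj_bounded.
by move=> t x; have [_ NN _] := N_proj hU htens t; rewrite cP NN.
Qed.

(** The smaller gap D and the larger D' satisfy D D' = D' D = D, so D X D = D (D' X D') D, and D is
    a contraction. *)
Lemma local_bound_shrink X r u v a b : 0 <= r -> u <= a -> a <= b -> b <= v ->
  (forall x, nrm (N v (X (N v x - N u x)) - N u (X (N v x - N u x))) <= r * nrm x) ->
  forall x, nrm (N b (X (N b x - N a x)) - N a (X (N b x - N a x))) <= r * nrm x.
Proof.
move=> r0 ua ab bv Xr x; set y := N b x - N a x.
have yE : N v y - N u y = y by exact: gap_comp.
rewrite -(gap_comp_outer hU htens (X y) ua ab bv) /=.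
apply: le_trans (proj_nrm _ (gap_proj hU htens ab)) _.
have := Xr y; rewrite yE => /le_trans; apply.
by rewrite ler_wpM2l// (proj_nrm _ (gap_proj hU htens ab)).
Qed.

Lemma local_bound_common t X Y r s : 0 <= r -> 0 <= s ->
  loc t X r -> loc t Y s -> exists u v, [/\ u < t, t < v,
    forall x, nrm (N v (X (N v x - N u x)) - N u (X (N v x - N u x))) <= r * nrm x &
    forall x, nrm (N v (Y (N v x - N u x)) - N u (Y (N v x - N u x))) <= s * nrm x].
Proof.
move=> r0 s0 [u [v [ut tv Xr]]] [u' [v' [ut' tv' Ys]]].
exists (Num.max u u'), (Num.min v v').
have h1 : Num.max u u' < t by rewrite gt_max ut.
have h2 : t < Num.min v v' by rewrite lt_min tv.
have h3 := ltW (lt_trans h1 h2).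
by split=> //; [apply: local_bound_shrink Xr|apply: local_bound_shrink Ys];
  rewrite ?le_max ?ge_min ?lexx ?orbT.
Qed.

Lemma local_bound_le t X r s : r <= s -> loc t X r -> loc t X s.
Proof.
move=> rs [u [v [ut tv Xr]]]; exists u, v; split=> // x.
by apply: le_trans (Xr x) _; rewrite ler_wpM2r ?nrm_ge0.
Qed.

Lemma local_boundD t X Y r s : 0 <= r -> 0 <= s -> loc t X r -> loc t Y s ->
  loc t (fun x => X x + Y x) (r + s).
Proof.
move=> r0 s0 Xr Ys; have [u [v [ut tv {}Xr {}Ys]]] := local_bound_common r0 s0 Xr Ys.
exists u, v; split=> // x; set y := N v x - N u x.
have [lv _ _] := N_proj hU htens v; have [lu _ _] := N_proj hU htens u.
rewrite (linD lv) (linD lu) opprD addrACA mulrDl.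
by apply: le_trans (nrmD _ _) _; apply: lerD; [exact: Xr|exact: Ys].
Qed.

Lemma local_boundZ t (a : R[i]) X r :
  loc t X r -> loc t (fun x => a *: X x) (complex.Re `|a| * r).
Proof.
move=> [u [v [ut tv Xr]]]; exists u, v; split=> // x; set y := N v x - N u x.
have [lv _ _] := N_proj hU htens v; have [lu _ _] := N_proj hU htens u.
rewrite (linZ lv) (linZ lu) -scalerBr nrmZ -mulrA; apply: ler_wpM2l; last exact: Xr.
by rewrite -ler0c RRe_real ?normr_real.
Qed.

(* With D = N v - N u, nest-invariance gives D X Y D = (D X D) (D Y D). *)
Lemma local_boundM t X Y r s : in_nest_alg X -> in_nest_alg Y -> 0 <= r -> 0 <= s ->
  loc t X r -> loc t Y s -> loc t (X \o Y) (r * s).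
Proof.
move=> [[lX _] aX] [[lY _] aY] r0 s0 Xr Ys.
have [u [v [ut tv {}Xr {}Ys]]] := local_bound_common r0 s0 Xr Ys.
exists u, v; split=> // x; set y := N v x - N u x.
have uv : u <= v by rewrite ltW// (lt_trans ut).
have [lv vv _] := N_proj hU htens v; have [lu uu _] := N_proj hU htens u.
have yE : y = N v y by rewrite /y (linB lv) vv (N_mono hU htens x uv).2.
have XYE : N v (X (Y y)) - N u (X (Y y)) =
    N v (X (N v (Y y) - N u (Y y))) - N u (X (N v (Y y) - N u (Y y))).
  have YE : N v (Y y) = Y y by rewrite yE aY.
  rewrite YE (linB lX) (linB lv) (linB lu).
  have -> : N v (X (N u (Y y))) = X (N u (Y y)).
    by rewrite -aX (N_mono hU htens _ uv).2.
  by rewrite aX opprB addrA subrK.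
rewrite /= XYE; set z := N v (Y y) - N u (Y y).
have zE : N v z - N u z = z by apply: (gap_comp hU htens).
have := Xr z; rewrite zE => /le_trans; apply.
by rewrite -mulrA ler_wpM2l//; exact: Ys.
Qed.

Lemma local_bound_global t X c : (forall x, nrm (X x) <= c * nrm x) -> 0 <= c ->
  loc t X c.
Proof.
move=> Xc c0; exists (t - 1), (t + 1).
split; [by rewrite ltrBlDr ltrDl|by rewrite ltrDl|move=> x].
have t11 : t - 1 <= t + 1 by lra.
apply: le_trans (proj_nrm _ (gap_proj hU htens t11)) _.
apply: le_trans (Xc _) _; rewrite ler_wpM2l//.
exact: (proj_nrm _ (gap_proj hU htens t11)).
Qed.

(** One notion for all three conditions of the system: rows and columns give sequences in the
    cut-off k, matrix entries give constant sequences. *)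
Definition tends0 t (Z : nat -> L -> L) : Prop :=
  forall eps, 0 < eps -> exists n, forall k, (n <= k)%N -> loc t (Z k) eps.

Lemma tends0D t Z W : tends0 t Z -> tends0 t W ->
  tends0 t (fun k x => Z k x + W k x).
Proof.
move=> Z0 W0 eps e0; have e2 : 0 < eps / 2 by lra.
have [n Zn] := Z0 _ e2; have [m Wm] := W0 _ e2.
exists (maxn n m) => k; rewrite geq_max => /andP[nk mk].
by rewrite [eps]splitr; apply: local_boundD; [exact: ltW|exact: ltW|exact: Zn|exact: Wm].
Qed.

Lemma tends00 t : tends0 t (fun _ _ => 0).
Proof.
move=> eps e0; exists 0 => k _; apply: local_bound_global; last exact: ltW.
by move=> x; rewrite nrm0 mulr_ge0 ?nrm_ge0 ?(ltW e0).
Qed.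

Lemma tends0_sum t n (Z : 'I_n -> nat -> L -> L) : (forall i, tends0 t (Z i)) ->
  tends0 t (fun k x => \sum_(i < n) Z i k x).
Proof.
elim: n Z => [|n IH] Z Z0.
  by under eq_fun do under eq_fun do rewrite big_ord0; exact: tends00.
under eq_fun do under eq_fun do rewrite big_ord_recr.
by apply: tends0D => //; exact: IH.
Qed.

Lemma tends0Z t (a : R[i]) Z : tends0 t Z -> tends0 t (fun k x => a *: Z k x).
Proof.
move=> Z0 eps e0; set c := complex.Re `|a|.
have c0 : 0 <= c by rewrite -ler0c RRe_real ?normr_real.
have [|n Zn] := Z0 (eps / (c + 1)); first by rewrite divr_gt0// ltr_wpDl.
exists n => k nk; apply: local_bound_le (local_boundZ a (Zn k nk)).
by rewrite -/c mulrCA ler_piMr ?(ltW e0)// ler_pdivrMr ?mul1r ?lerDl// ltr_wpDl.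
Qed.

Lemma tends0_mulr t Z W c : tends0 t Z -> (forall k, in_nest_alg (Z k)) ->
  (forall k, in_nest_alg (W k)) -> 0 <= c -> (forall k x, nrm (W k x) <= c * nrm x) ->
  tends0 t (fun k => Z k \o W k).
Proof.
move=> Z0 aZ aW c0 Wc eps e0; have c1 : 0 < c + 1 by rewrite ltr_wpDl.
have d0 := divr_gt0 e0 c1.
have [n Zn] := Z0 _ d0; exists n => k nk.
apply: local_bound_le (local_boundM (aZ k) (aW k) (ltW d0) c0 (Zn k nk)
  (local_bound_global t (Wc k) c0)).
by rewrite mulrAC -mulrA ler_piMr ?(ltW e0)// ler_pdivrMr ?mul1r ?lerDl.
Qed.

Lemma tends0_mull t Z W c : tends0 t Z -> (forall k, in_nest_alg (Z k)) ->
  (forall k, in_nest_alg (W k)) -> 0 <= c -> (forall k x, nrm (W k x) <= c * nrm x) ->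
  tends0 t (fun k => W k \o Z k).
Proof.
move=> Z0 aZ aW c0 Wc eps e0; have c1 : 0 < c + 1 by rewrite ltr_wpDl.
have d0 := divr_gt0 e0 c1.
have [n Zn] := Z0 _ d0; exists n => k nk.
apply: local_bound_le (local_boundM (aW k) (aZ k) c0 (ltW d0)
  (local_bound_global t (Wc k) c0) (Zn k nk)).
by rewrite mulrCA ler_piMr ?(ltW e0)// ler_pdivrMr ?mul1r ?lerDl.
Qed.

Lemma tends0_cst t X : tends0 t (fun=> X) <-> forall eps, 0 < eps -> loc t X eps.
Proof.
split=> [X0 eps e0|X0 eps e0]; last by exists 0 => k _; exact: X0.
by have [n Xn] := X0 eps e0; exact: (Xn n).
Qed.

Lemma loc_contr_r t X P eps : in_nest_alg X -> projection P -> in_nest_alg P -> 0 < eps ->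
  loc t X eps -> loc t (X \o P) eps.
Proof.
move=> aX pP aP e0 Xe; have P1 x : nrm (P x) <= 1 * nrm x.
  by rewrite mul1r; exact: proj_nrm.
rewrite -[eps]mulr1; apply: local_boundM => //; [exact: ltW|].
exact: (local_bound_global t P1).
Qed.

Lemma loc_contr_l t X P eps : in_nest_alg X -> projection P -> in_nest_alg P -> 0 < eps ->
  loc t X eps -> loc t (P \o X) eps.
Proof.
move=> aX pP aP e0 Xe; have P1 x : nrm (P x) <= 1 * nrm x.
  by rewrite mul1r; exact: proj_nrm.
rewrite -[eps]mul1r; apply: local_boundM => //; [exact: ltW|].
exact: (local_bound_global t P1).
Qed.

Lemma tends0_near0 t (Z : nat -> L -> L) n :
  (forall k x, (n <= k)%N -> Z k x = 0) -> tends0 t Z.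
Proof.
move=> Z0 eps e0; exists n => k nk.
apply: (local_bound_global _ _ (ltW e0)) => x.
by rewrite Z0// nrm0 mulr_ge0 ?nrm_ge0// ltW.
Qed.

Lemma gap_bounded X u v : u <= v -> bounded_op X ->
  bounded_op ((N v \- N u) \o X \o (N v \- N u)).
Proof.
move=> uv bX; have bD := proj_bounded (gap_proj hU htens uv).
exact: comp_bounded (comp_bounded bD bX) bD.
Qed.

Lemma local_norm_ge0 t X : 0 <= local_norm N t X.
Proof. by apply: inf_lb0 => r [u [v [_ _ ->]]]; exact: opnorm_ge0. Qed.

Lemma local_norm_le t X r : 0 <= r -> loc t X r -> local_norm N t X <= r.
Proof.
move=> r0 [u [v [ut tv Xr]]].
apply: (@le_trans _ _ (opnorm ((N v \- N u) \o X \o (N v \- N u)))); last first.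
  exact: opnorm_le.
apply: inf_le; last by exists u, v.
by move=> s [u' [v' [_ _ ->]]]; exact: opnorm_ge0.
Qed.

(** Boundedness makes the set defining [opnorm] nonempty; the infimum of the empty set is 0 by
    convention and would bound nothing. *)
Lemma local_norm_lt t X r : bounded_op X -> local_norm N t X < r -> loc t X r.
Proof.
move=> bX /inf_lt[].
- exists (opnorm ((N (t + 1) \- N (t - 1)) \o X \o (N (t + 1) \- N (t - 1)))).
  by exists (t - 1), (t + 1); split; rewrite ?ltrBlDr ?ltrDl.
- by move=> s [u' [v' [_ _ ->]]]; exact: opnorm_ge0.
move=> _ [u [v [ut tv ->]]] Xr; exists u, v; split=> //.
by apply: (opnorm_lt _ Xr); apply: gap_bounded => //; rewrite ltW// (lt_trans ut).
Qed.

Lemma local_norm_eq0 t X : bounded_op X ->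
  local_norm N t X = 0 <-> forall eps, 0 < eps -> loc t X eps.
Proof.
move=> bX; split=> [X0 eps e0|Xe].
  by apply: local_norm_lt => //; rewrite X0.
apply/eqP; rewrite eq_le local_norm_ge0 andbT; apply/ler_addgt0Pl => eps e0.
by rewrite addr0; apply: local_norm_le; [exact: ltW|exact: Xe].
Qed.

Lemma limn_local_norm_eq0 t (Z : nat -> L -> L) : (forall k, bounded_op (Z k)) ->
  (forall m n eps, (m <= n)%N -> 0 < eps -> loc t (Z m) eps -> loc t (Z n) eps) ->
  limn (fun k => local_norm N t (Z k)) = 0 <-> tends0 t Z.
Proof.
move=> bZ mZ.
have dec m n : (m <= n)%N -> local_norm N t (Z n) <= local_norm N t (Z m).
  move=> mn; apply/ler_addgt0Pl => eps e0.
  (* A local bound is extracted strictly above the infimum, hence the slack [eps]; it also makes the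
     bound positive, as the hypothesis [mZ] requires. *)
  have p0 : 0 < eps + local_norm N t (Z m) by rewrite ltr_pwDl// local_norm_ge0.
  apply: local_norm_le (ltW p0) _; apply: (mZ m) => //.
  by apply: local_norm_lt => //; rewrite ltrDr.
apply: (iff_trans (limn_nonincreasing0 dec (fun k => local_norm_ge0 t (Z k)))).
split=> small eps e0.
- have [n Zn] := small eps e0; exists n => k nk.
  by apply: (mZ n) => //; apply: local_norm_lt.
- have e2 : 0 < eps / 2 by lra.
  have [n Zn] := small _ e2; exists n.
  have := local_norm_le (ltW e2) (Zn n (leqnn n)); lra.
Qed.

End LocalBounds.

(** * The algebra of an extended triangular system *)

Section SystemAlgebra.
Variables (R : realType) (H K L : hilbertType R) (U : (R -> R[i]) -> H).
Hypothesis hU : L2_unitary U.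
Variable tens : {bilinear H -> K -> L}.
Hypothesis htens : hilbert_tensor tens.
Variable e : nat -> K.
Hypothesis he : orthonormal_basis e.
Notation mu := (@lebesgue_measure R).
Notation N := (nest_proj U tens).
Notation E := (basis_proj tens e).
Notation Q := (partial_compl E).
Notation in_nest_alg := (in_nest_alg U tens).
Notation loc := (local_bound U tens).
Notation tends0 := (tends0 U tens).
Implicit Types X Y : L -> L.

(** * Basis projections and the complements of their partial sums *)

Let E_proj i : projection (E i) := (E_spec htens he i).1.

Lemma E_alg i : in_nest_alg (E i).
Proof. by apply: in_nest_alg_proj => // t x; exact: NE_comm. Qed.

Lemma EE i j x : E i (E j x) = if i == j then E i x else 0.
Proof.
by case: eqP => [->|/eqP ij]; [case: (E_proj j)|exact: E_orth].
Qed.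

Lemma sumEE n i x : \sum_(j < n) E i (E j x) = if (i < n)%N then E i x else 0.
Proof.
under eq_bigr do rewrite EE; rewrite -big_mkcond /=.
case: ltnP => ni.
  by rewrite (big_pred1 (Ordinal ni))// => j; rewrite eq_sym.
by rewrite big_pred0// => j; rewrite gtn_eqF// (leq_trans (ltn_ord j)).
Qed.

Lemma EQ n i x : E i (Q n x) = if (i < n)%N then 0 else E i x.
Proof.
have [lE _ _] := E_proj i.
rewrite /partial_compl (linB lE) (lin_sum lE) sumEE.
by case: ifP; rewrite ?subrr ?subr0.
Qed.

Lemma Q_proj n : projection (Q n).
Proof.
have lQ : linear (Q n).
  move=> a x y; rewrite /partial_compl scalerBr scaler_sumr addrACA -opprD.
  rewrite -big_split /=; congr (_ - _); apply: eq_bigr => i _.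
  by have [lE _ _] := E_proj i; rewrite lE.
split=> // [x|x y].
- rewrite {1}/partial_compl big1 ?subr0// => i _.
  by rewrite EQ ltn_ord.
- rewrite /partial_compl dotpBl dotpBr dotp_suml dotp_sumr; congr (_ - _).
  by apply: eq_bigr => i _; have [_ _ sE] := E_proj i; rewrite sE.
Qed.

Lemma QE n i x : Q n (E i x) = if (i < n)%N then 0 else E i x.
Proof.
have [_ _ sQ] := Q_proj n; have [lE _ sE] := E_proj i.
apply: dotp_inj => z; rewrite sQ sE EQ.
by case: ifP => _; rewrite ?dotp0l ?dotp0r// sE.
Qed.

Lemma QQ m n x : (m <= n)%N -> Q m (Q n x) = Q n x.
Proof.
move=> mn; rewrite {1}/partial_compl big1 ?subr0// => i _.
by rewrite EQ (leq_trans (ltn_ord i)).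
Qed.

Lemma QQr m n x : (m <= n)%N -> Q n (Q m x) = Q n x.
Proof.
move=> mn; have [_ _ sm] := Q_proj m; have [_ _ sn] := Q_proj n.
by apply: dotp_inj => z; rewrite sn sm QQ// sn.
Qed.

Lemma Q_alg n : in_nest_alg (Q n).
Proof.
apply: in_nest_alg_proj => //; first exact: Q_proj.
move=> t x; have [lN _ _] := N_proj hU htens t.
rewrite /partial_compl (linB lN) (lin_sum lN); congr (_ - _).
by apply: eq_bigr => i _; exact: NE_comm.
Qed.

Lemma Q_split n x : x = \sum_(i < n) E i x + Q n x.
Proof. by rewrite /partial_compl addrC subrK. Qed.

(* A B is the sum over l < n of (A E_l)(E_l B), plus A Q_n B; the last term is
   small uniformly in k once n is large. *)
Lemma tends0_product t (A B : nat -> L -> L) a b :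
  (forall k, in_nest_alg (A k)) -> (forall k, in_nest_alg (B k)) -> 0 <= a -> 0 <= b ->
  (forall k x, nrm (A k x) <= a * nrm x) -> (forall k x, nrm (B k x) <= b * nrm x) ->
  (forall l, tends0 t (fun k => A k \o E l) \/ tends0 t (fun k => E l \o B k)) ->
  (forall eps, 0 < eps -> exists n, forall k, loc t (A k \o Q n) eps) \/
  (forall eps, 0 < eps -> exists n, forall k, loc t (Q n \o B k) eps) ->
  tends0 t (fun k => A k \o B k).
Proof.
move=> aA aB a0 b0 Aa Bb middle tail eps e0.
have head n : tends0 t (fun k x => \sum_(l < n) A k (E l (B k x))).
  apply: tends0_sum => // l.
  have -> : (fun k x => A k (E l (B k x))) = (fun k => (A k \o E l) \o (E l \o B k)).
    by apply/funext => k; apply/funext => x /=; have [_ -> _] := E_proj l.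
  have EB k x : nrm ((E l \o B k) x) <= b * nrm x.
    exact: le_trans (proj_nrm _ (E_proj l)) (Bb k x).
  have AE k x : nrm ((A k \o E l) x) <= a * nrm x.
    apply: le_trans (Aa k _) _; apply: ler_wpM2l => //.
    exact: proj_nrm (E_proj l).
  have aAE k : in_nest_alg (A k \o E l) by apply: in_nest_alg_comp => //; exact: E_alg.
  have aEB k : in_nest_alg (E l \o B k) by apply: in_nest_alg_comp => //; exact: E_alg.
  have [m|m] := middle l.
  - exact: (tends0_mulr hU htens m aAE aEB b0 EB).
  - exact: (tends0_mull hU htens m aEB aAE a0 AE).
have [n rest] : exists n, forall k, loc t (A k \o Q n \o B k) (eps / 2).
  case: tail => tail.
  - have d0 : 0 < eps / 2 / (b + 1) by rewrite !divr_gt0// ltr_wpDl.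
    have [n An] := tail _ d0; exists n => k.
    have aAQ : in_nest_alg (A k \o Q n) by apply: in_nest_alg_comp => //; exact: Q_alg.
    apply: local_bound_le (local_boundM hU htens aAQ (aB k) (ltW d0) b0 (An k)
      (local_bound_global hU htens t (Bb k) b0)).
    rewrite mulrAC -mulrA ler_piMr//; first by rewrite ltW// divr_gt0.
    by rewrite ler_pdivrMr ?mul1r ?lerDl// ltr_wpDl.
  - have d0 : 0 < eps / 2 / (a + 1) by rewrite !divr_gt0// ltr_wpDl.
    have [n Bn] := tail _ d0; exists n => k.
    have aQB : in_nest_alg (Q n \o B k) by apply: in_nest_alg_comp => //; exact: Q_alg.
    apply: local_bound_le (local_boundM hU htens (aA k) aQB a0 (ltW d0)
      (local_bound_global hU htens t (Aa k) a0) (Bn k)).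
    rewrite mulrCA ler_piMr//; first by rewrite ltW// divr_gt0.
    by rewrite ler_pdivrMr ?mul1r ?lerDl// ltr_wpDl.
have e2 : 0 < eps / 2 by rewrite divr_gt0.
have [m headm] := head n _ e2; exists m => k mk.
have -> : A k \o B k = fun x => \sum_(l < n) A k (E l (B k x)) + A k (Q n (B k x)).
  apply/funext => x /=; have [[lA _] _] := aA k.
  by rewrite -(lin_sum lA) -(linD lA) -Q_split.
rewrite [eps]splitr; apply: local_boundD (ltW e2) (ltW e2) (headm k mk) (rest k) => //.
Qed.

Variables (S : nat -> nat -> set R) (Rw C : nat -> set R).

(** All conditions of the system at one point, so that the closure properties can be proved point by
    point, with the null set handled separately. *)
Definition good_at (t : R) X : Prop :=
  [/\ forall i j, ~ S i j t -> tends0 t (fun=> E i \o X \o E j),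
      forall i, ~ Rw i t -> tends0 t (fun k => E i \o X \o Q k) &
      forall j, ~ C j t -> tends0 t (fun k => Q k \o X \o E j)].

Lemma row_norm_eq0 t i X : in_nest_alg X ->
  row_norm N E i t X = 0 <-> tends0 t (fun k => E i \o X \o Q k).
Proof.
move=> aX.
have aEX : in_nest_alg (E i \o X) by apply: in_nest_alg_comp => //; exact: E_alg.
have aZ k : in_nest_alg (E i \o X \o Q k) by apply: in_nest_alg_comp => //; exact: Q_alg.
apply: (limn_local_norm_eq0 hU htens) => [k|m n eps mn e0 loc_m].
  by have [] := aZ k.
(* Multiplying by the contraction Q_n preserves local bounds, which makes the sequence monotone in
   the sense needed for its limit. *)
have -> : E i \o X \o Q n = (E i \o X \o Q m) \o Q n.
  by apply/funext => x /=; rewrite QQ.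
by apply: loc_contr_r => //; [exact: Q_proj|exact: Q_alg].
Qed.

Lemma col_norm_eq0 t j X : in_nest_alg X ->
  col_norm N E j t X = 0 <-> tends0 t (fun k => Q k \o X \o E j).
Proof.
move=> aX.
have aXE : in_nest_alg (X \o E j) by apply: in_nest_alg_comp => //; exact: E_alg.
have aZ k : in_nest_alg (Q k \o X \o E j) by apply: (in_nest_alg_comp (Q_alg k)).
apply: (limn_local_norm_eq0 hU htens) => [k|m n eps mn e0 loc_m].
  by have [] := aZ k.
have -> : Q n \o X \o E j = Q n \o (Q m \o X \o E j).
  by apply/funext => x /=; rewrite QQr.
by apply: loc_contr_l => //; [exact: Q_proj|exact: Q_alg].
Qed.

Lemma nest_algE X : nest_alg (nest U tens) X <-> in_nest_alg X.
Proof.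
split=> [[bX XN]|[bX XN]]; split=> //.
- move=> t x; have [[_ ->]|[_ ->]|t01] := N_cases U tens t => //.
    by have [lX _] := bX; rewrite (lin0 lX).
  have nestN : nest U tens (N t).
    exists (mul_indic U `[0, t]%classic); first by exists t => //=; rewrite in_itv.
    by rewrite N_inner.
  have [|y _ <-] := XN _ nestN (X (N t x)); first by exists (N t x) => //; exists x.
  by have [_ -> _] := N_proj hU htens t.
- move=> _ [_ [t t01 <-] <-] _ [_ [x _ <-] <-].
  rewrite /= in_itv/= in t01; rewrite -N_inner//.
  by exists (X (N t x)) => //; exact: XN.
Qed.

(** The conditions are indexed by countably many i and j, so their exceptional null sets have a null
    union. *)
Lemma system_algebraP X : system_algebra U tens e S Rw C X <->
  in_nest_alg X /\ {ae mu, forall t, t \in `[0, 1] -> good_at t X}.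
Proof.
have aEXE i j : in_nest_alg X -> bounded_op (E i \o X \o E j).
  by move=> aX; have [] := in_nest_alg_comp (in_nest_alg_comp (E_alg i) aX) (E_alg j).
split.
- move=> [/nest_algE aX XS XR XC]; split=> //.
  have XS' : {ae mu, forall t, forall i j, t \in `[0, 1] -> ~ S i j t ->
      local_norm N t (E i \o X \o E j) = 0}.
    by apply: ae_foralln => i; exact: ae_foralln.
  have {}XR : {ae mu, forall t, forall i, t \in `[0, 1] -> ~ Rw i t ->
      row_norm N E i t X = 0} by exact: ae_foralln.
  have {}XC : {ae mu, forall t, forall j, t \in `[0, 1] -> ~ C j t ->
      col_norm N E j t X = 0} by exact: ae_foralln.
  move: XS' XR XC; apply: filterS3.
  move=> t XS' XR XC t01; split.
  + move=> i j St; apply/tends0_cst/(local_norm_eq0 hU htens); first exact: aEXE.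
    exact: XS'.
  + by move=> i Rt; apply/row_norm_eq0 => //; exact: XR.
  + by move=> j Ct; apply/col_norm_eq0 => //; exact: XC.
- move=> [aX good]; split; first exact/nest_algE.
  + move=> i j; move: good; apply: filterS.
    move=> t /[apply] -[XS _ _] /XS /tends0_cst XS'.
    by apply/(local_norm_eq0 hU htens); [exact: aEXE|exact: XS'].
  + move=> i; move: good; apply: filterS.
    by move=> t /[apply] -[_ XR _] /XR ?; apply/row_norm_eq0.
  + move=> j; move: good; apply: filterS.
    by move=> t /[apply] -[_ _ XC] /XC ?; apply/col_norm_eq0.
Qed.

Hypothesis hSRC : extended_triangular_system S Rw C.

(** For an entry off S_ij, transitivity of S makes one factor of each middle term vanish, and R_i
    [&] C_j [<=] S_ij controls the tail. For rows the middle terms use S_il [&] R_l [<=] R_i and the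
    tail is the row of X; for columns they use C_l [&] S_lj [<=] C_j and the tail is the column of
    Y. *)
Lemma good_at_comp t X Y : in_nest_alg X -> in_nest_alg Y ->
  good_at t X -> good_at t Y -> good_at t (X \o Y).
Proof.
case: hSRC => _ [[_ _ S_trans C_S S_R] R_C].
move=> aX aY [XS XR XC] [YS YR YC].
have [x [x0 Xx]] := bounded_nrm aX.1; have [y [y0 Yy]] := bounded_nrm aY.1.
have aEX i : in_nest_alg (E i \o X) by apply: in_nest_alg_comp => //; exact: E_alg.
have aQX k : in_nest_alg (Q k \o X) by apply: in_nest_alg_comp => //; exact: Q_alg.
have aYE j : in_nest_alg (Y \o E j) by apply: in_nest_alg_comp => //; exact: E_alg.
have aYQ k : in_nest_alg (Y \o Q k) by apply: in_nest_alg_comp => //; exact: Q_alg.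
have bl P z : projection P -> nrm ((P \o X) z) <= x * nrm z.
  by move=> pP; exact: le_trans (proj_nrm _ pP) (Xx z).
have br P z : projection P -> nrm ((Y \o P) z) <= y * nrm z.
  by move=> pP; apply: le_trans (Yy _) _; apply: ler_wpM2l => //; exact: proj_nrm.
(* The premise [nat] matches the quantifier over k in the tail condition of [tends0_product], for a
   factor constant in k. *)
have row i : ~ Rw i t -> forall eps, 0 < eps ->
    exists n, nat -> loc t (E i \o X \o Q n) eps.
  by move=> Rt eps e0; have [n Xn] := XR i Rt eps e0; exists n => _; exact: Xn.
have col j : ~ C j t -> forall eps, 0 < eps ->
    exists n, nat -> loc t (Q n \o (Y \o E j)) eps.
  by move=> Ct eps e0; have [n Yn] := YC j Ct eps e0; exists n => _; exact: (Yn n).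
split.
- move=> i j St.
  apply: (@tends0_product t (fun=> E i \o X) (fun=> Y \o E j) x y) => //.
  + by move=> _ z; exact: bl.
  + by move=> _ z; exact: br.
  + move=> l; have [Sil|Sil] := pselect (S i l t); [right|by left; exact: XS].
    by apply: YS => Slj; apply: St; apply: (S_trans i l j).
  + have [Ri|Ri] := pselect (Rw i t); [right|by left; exact: row].
    by apply: col => Cj; apply: St; exact: R_C.
- move=> i Rt.
  apply: (@tends0_product t (fun=> E i \o X) (fun k => Y \o Q k) x y) => //.
  + by move=> _ z; exact: bl.
  + by move=> k z; apply: br; exact: Q_proj.
  + move=> l; have [Sil|Sil] := pselect (S i l t); [right|by left; exact: XS].
    by apply: YR => Rl; apply: Rt; apply: (S_R i l).
  + by left; exact: row.
- move=> j Ct.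
  apply: (@tends0_product t (fun k => Q k \o X) (fun=> Y \o E j) x y) => //.
  + by move=> k z; apply: bl; exact: Q_proj.
  + by move=> _ z; exact: br.
  + move=> l; have [Slj|Slj] := pselect (S l j t); [left|by right; exact: YS].
    by apply: XC => Cl; apply: Ct; apply: (C_S l j).
  + by right; exact: col.
Qed.

Lemma good_at_lin t (a : R[i]) X Y :
  good_at t X -> good_at t Y -> good_at t (fun x => a *: X x + Y x).
Proof.
move=> [XS XR XC] [YS YR YC].
have lin P P' : projection P -> P \o (fun x => a *: X x + Y x) \o P' =
    fun x => a *: (P \o X \o P') x + (P \o Y \o P') x.
  by move=> [lP _ _]; apply/funext => x /=; rewrite lP.
split.
- move=> i j St; rewrite lin//.
  by apply: tends0D => //; [apply: tends0Z => //; exact: XS|exact: YS].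
- move=> i Rt.
  have -> : (fun k => E i \o (fun x => a *: X x + Y x) \o Q k) =
      (fun k x => a *: (E i \o X \o Q k) x + (E i \o Y \o Q k) x).
    by apply/funext => k; exact: lin.
  by apply: tends0D => //; [apply: tends0Z => //; exact: XR|exact: YR].
- move=> j Ct.
  have -> : (fun k => Q k \o (fun x => a *: X x + Y x) \o E j) =
      (fun k x => a *: (Q k \o X \o E j) x + (Q k \o Y \o E j) x).
    by apply/funext => k; apply: lin; exact: Q_proj.
  by apply: tends0D => //; [apply: tends0Z => //; exact: XC|exact: YC].
Qed.

(** * The diagonal of the algebra *)

Definition in_diag X : Prop := bounded_op X /\ diagonal_op U tens e X.

Lemma in_diag_alg X : in_diag X -> in_nest_alg X.
Proof.
move=> [bX [_ cN _]]; split=> // t x.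
by rewrite cN; have [_ -> _] := N_proj hU htens t.
Qed.

Lemma in_diag_system X : in_diag X -> system_algebra U tens e S Rw C X.
Proof.
move=> dX; have [bX [lX cN cE]] := dX; apply/system_algebraP.
split; first exact: in_diag_alg.
apply: aeW => t t01; case: hSRC => _ [[Sii _ _ _ _] _]; split.
- move=> i j St; apply: (tends0_near0 hU htens t (n := 0)) => _ x _ /=; rewrite -cE EE.
  case: eqP => [ij|_]; last exact: lin0 lX.
  by exfalso; apply: St; rewrite ij Sii.
(* X commutes with E_i, so the row is X E_i Q_k; with indices from 0, Q_k removes E_i exactly when i
   < k. *)
- move=> i _; apply: (tends0_near0 hU htens t (n := i.+1)) => k x ik /=.
  by rewrite -cE EQ ik (lin0 lX).
- move=> j _; apply: (tends0_near0 hU htens t (n := j.+1)) => k x jk /=.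
  by rewrite cE QE jk.
Qed.

Notation T := (system_algebra U tens e S Rw C).

Lemma system_operator_algebra : operator_algebra T.
Proof.
split.
- by move=> X /system_algebraP[[]].
- apply: in_diag_system; split; last split.
  + by have [] := in_nest_alg0 hU htens.
  + by move=> a x y; rewrite scaler0 addr0.
  + by move=> t x; have [lN _ _] := N_proj hU htens t; rewrite (lin0 lN).
  + by move=> i x; have [lE _ _] := E_proj i; rewrite (lin0 lE).
- move=> a X Y /system_algebraP[aX gX] /system_algebraP[aY gY].
  apply/system_algebraP; split; first exact: in_nest_alg_lin.
  move: gX gY; apply: filterS2.
  by move=> t gX gY t01; apply: good_at_lin; [exact: gX|exact: gY].
- move=> X Y /system_algebraP[aX gX] /system_algebraP[aY gY].
  apply/system_algebraP; split; first exact: in_nest_alg_comp.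
  move: gX gY; apply: filterS2.
  by move=> t gX gY t01; apply: good_at_comp => //; [exact: gX|exact: gY].
Qed.

(** In the same window, D Y D is the adjoint of D X D, and its norm is estimated by duality. *)
Lemma local_bound_adjoint t X Y r : 0 <= r -> is_adjoint X Y ->
  loc t X r -> loc t Y r.
Proof.
move=> r0 XY [u [v [ut tv Xr]]]; exists u, v; split=> // x.
have uv : u <= v by rewrite ltW// (lt_trans ut).
have [_ _ sD] := gap_proj hU htens uv.
apply: nrm_bound; first by rewrite mulr_ge0 ?nrm_ge0.
move=> y; rewrite sD (adjointC XY) sD; apply: le_trans (dot_CS _ _) _.
by rewrite lecR mulrAC mulrC ler_wpM2r ?nrm_ge0// ?Xr.
Qed.

Lemma system_adjoint_diag X Y : T X -> T Y -> is_adjoint X Y -> diagonal_op U tens e Y.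
Proof.
move=> /system_algebraP[aX gX] /system_algebraP[aY gY] XY.
have YX := adjointC XY.
have [[lX _] NX] := aX; have [[lY _] NY] := aY.
(* Y in Alg(N) means N Y N = Y N; the adjoint of N X N = X N is N Y N = N Y. *)
have cN t x : Y (N t x) = N t (Y x).
  have [_ _ sN] := N_proj hU htens t.
  rewrite -NY; apply: dotp_inj => z.
  by rewrite !sN YX YX sN NX.
have off i j x : i != j -> E i (Y (E j x)) = 0.
  move=> ij; move: x; have [lEi EEi sEi] := E_proj i; have [lEj EEj sEj] := E_proj j.
  apply: (@locally_zero_eq0 _ _ _ _ _ hU _ htens _ he (fun x => E i (Y (E j x))) i j).
  - by move=> a x y; rewrite lEj lY lEi.
  - by move=> t x; rewrite -(NE_comm hU htens he) cN -(NE_comm hU htens he).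
  - by move=> x /=; rewrite EEj EEi.
  move: gX gY; apply: filterS2.
  move=> t gX gY t01 eps e0.
  have [[gX' _ _] [gY' _ _]] := (gX t01, gY t01).
  case: hSRC => _ [[_ S_disj _ _ _] _].
  (* Off S_ij, smallness is a condition on Y itself. On S_ij the point is off S_ji, so E_j X E_i is
     locally small, and its adjoint is E_i Y E_j. *)
  have [Sij|Sij] := pselect (S i j t); last by move/tends0_cst: (gY' i j Sij); apply.
  have nSji : ~ S j i t.
    move=> Sji; have : (S i j `&` S j i) t by [].
    by rewrite S_disj//; apply/eqP.
  have /tends0_cst/(_ eps e0) := gX' j i nSji.
  apply: local_bound_adjoint (ltW e0) _ => x y /=.
  by rewrite sEj XY sEi.
split=> // i x; apply/eqP; rewrite -subr_eq0; apply/eqP.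
apply: (E_total htens he) => j; have [lEj _ _] := E_proj j.
rewrite (linB lEj) EE; case: eqP => [->|/eqP ji]; last by rewrite off// subr0.
(* What remains is E_i Y = E_i Y E_i. The components seen by [E_total] are on the left, so the
   identity is proved as the adjoint of X E_i = E_i X E_i. *)
have XE z : X (E i z) = E i (X (E i z)).
  apply/eqP; rewrite -subr_eq0; apply/eqP; apply: (E_total htens he) => l.
  have [lEl _ sEl] := E_proj l; rewrite (linB lEl) EE.
  case: eqP => [->|/eqP li]; first by rewrite subrr.
  have [_ _ sEi] := E_proj i; rewrite subr0; apply: dotp_inj => w.
  by rewrite sEl XY sEi off ?dotp0l ?dotp0r// eq_sym.
have [_ _ sEi] := E_proj i; apply/eqP; rewrite subr_eq0; apply/eqP.
by apply: dotp_inj => z; rewrite sEi YX sEi -XE sEi YX.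
Qed.

Lemma in_diagE Y : (T `&` adjoint_set T) Y <->
  in_diag Y /\ exists2 X, in_diag X & is_adjoint X Y.
Proof.
split.
- move=> [TY [X TX XY]].
  have bX : bounded_op X by move: TX => /system_algebraP[[]].
  have bY : bounded_op Y by move: TY => /system_algebraP[[]].
  have dY := system_adjoint_diag TX TY XY.
  have dX := system_adjoint_diag TY TX (adjointC XY).
  by split=> //; exists X.
- move=> [dY [X dX XY]]; split; first exact: in_diag_system.
  by exists X => //; exact: in_diag_system.
Qed.

Lemma diag_self_adjoint P : projection P -> diagonal_op U tens e P ->
  (T `&` adjoint_set T) P.
Proof.
move=> pP dP; have iP : in_diag P by split=> //; exact: proj_bounded.
by apply/in_diagE; split=> //; exists P => //; case: pP.
Qed.

Lemma diag_algebra : abelian_selfadjoint_algebra (T `&` adjoint_set T).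
Proof.
have [Tb T0 Tlin Tmul] := system_operator_algebra.
split.
- split.
  + by move=> X [/Tb].
  + by split=> //; exists (fun=> 0) => // x y; rewrite dotp0l dotp0r.
  + move=> a X Y [TX [X' TX' XX']] [TY [Y' TY' YY']]; split; first exact: Tlin.
    exists (fun x => a^* *: X' x + Y' x); first exact: Tlin.
    by move=> x y; rewrite dotpDl dotpDr dotpZl dotpZr XX' YY'.
  + move=> X Y [TX [X' TX' XX']] [TY [Y' TY' YY']]; split; first exact: Tmul.
    by exists (Y' \o X'); [exact: Tmul|move=> x y /=; rewrite YY' XX'].
- rewrite eqEsubset; split=> [Y [X [TX [W TW WX]] XY]|Y [TY [X TX XY]]].
  + have WY : W = Y := adjoint_unique (adjointC WX) XY.
    by rewrite -WY; split=> //; exists X => //; exact: adjointC.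
  + by exists X => //; split=> //; exists Y => //; exact: adjointC.
- move=> X Y /in_diagE[[_ dX] [X' [_ dX'] XX']] /in_diagE[[_ dY] [Y' [_ dY'] YY']].
  apply/funext => x /=.
  exact: (diagonal_comm hU htens he x (adjointC XX') (adjointC YY')).
Qed.

Lemma diag_maximal B : abelian_selfadjoint_algebra B ->
  T `&` adjoint_set T `<=` B -> B `<=` T `&` adjoint_set T.
Proof.
move=> [[Bb _ _ _] Bsa Bc] DB.
have NB t : B (N t).
  apply/DB/diag_self_adjoint; first exact: N_proj.
  have [lN _ _] := N_proj hU htens t; split=> //.
  - move=> s x; have [st|/ltW ts] := leP s t.
      by rewrite (N_mono hU htens x st).1 (N_mono hU htens x st).2.
    by rewrite (N_mono hU htens x ts).1 (N_mono hU htens x ts).2.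
  - by move=> i x; exact: NE_comm.
have EB i : B (E i).
  apply: DB; apply: diag_self_adjoint => //.
  have [lE _ _] := E_proj i; split=> // [t x|j x].
  - by rewrite (NE_comm hU htens he).
  - by rewrite !EE eq_sym; case: eqP => // ->.
have Bdiag Z : B Z -> in_diag Z.
  move=> BZ; have bZ := Bb _ BZ; split=> //; have [lZ _] := bZ; split=> //.
  - by move=> t x; exact: (congr1 (@^~ x) (Bc _ _ BZ (NB t))).
  - by move=> i x; exact: (congr1 (@^~ x) (Bc _ _ BZ (EB i))).
move=> Z BZ; apply/in_diagE; split; first exact: Bdiag.
(* The adjoint required by [in_diagE] is supplied by the self-adjointness of B, and it lies in B
   again, hence in the commutant. *)
have : adjoint_set B Z by rewrite Bsa.
by move=> [X BX XZ]; exists X => //; exact: Bdiag.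
Qed.

End SystemAlgebra.

Theorem theorem3p8 (R : realType) (H K L : hilbertType R)
    (U : (R -> complex R) -> H) (hU : L2_unitary U)
    (tens : {bilinear H -> K -> L}) (htens : hilbert_tensor tens)
    (e : nat -> K) (he : orthonormal_basis e)
    (S : nat -> nat -> set R) (Rw C : nat -> set R)
    (hSRC : extended_triangular_system S Rw C) :
  triangular_algebra (system_algebra U tens e S Rw C).
Proof.
split; first exact: system_operator_algebra.
by split; [exact: diag_algebra|exact: diag_maximal].
Qed.
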